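(* Let $w\in\mathfrak S_n$ avoid the pattern $4231$, not avoid the pattern $3412$, and satisfy $\mathrm{gap}_{3412}(w)>1$. Then the modified Kazhdan--Lusztig basis element $\widetilde C_w(q)$ has no reversal factorization; that is, there is no finite sequence of intervals $\mathcal A=([a_1,b_1],\dots,[a_m,b_m])$ in $[n]$ with $$\widetilde C_w(q)=\frac{1}{f_{\mathcal A}(q)}\,\widetilde C_{s_{[a_1,b_1]}}(q)\cdots \widetilde C_{s_{[a_m,b_m]}}(q).$$
   Context: $\mathfrak S_n$ is the symmetric group with generators $s_1,\dots,s_{n-1}$, length function $\ell$ and Bruhat order $\le$. A permutation $w$ avoids a pattern $u\in\mathfrak S_k$ if no subword of the one-line notation of $w$ has its letters in the same relative order as $u$. For $w$ not avoiding $3412$, $\mathrm{gap}_{3412}(w)=\min\{w_{i_1}-w_{i_4}: i_1<i_2<i_3<i_4,\ w_{i_1}w_{i_2}w_{i_3}w_{i_4}\text{ matches }3412\}$. For an interval $[a,b]\subseteq[n]$, the reversal $s_{[a,b]}=1\cdots(a-1)\,b\,(b-1)\cdots a\,(b+1)\cdots n$ (one-line notation). The Hecke algebra $H_n(q)$ is the free $\mathbb Z[q^{1/2},q^{-1/2}]$-module with basis $\{T_w: w\in\mathfrak S_n\}$ and multiplication $T_{s_i}T_w=T_{s_iw}$ if $s_iw>w$, $T_{s_i}T_w=(q-1)T_{s_iw}+qT_w$ if $s_iw<w$. The bar involution is the semilinear involution with $\overline{q^{1/2}}=q^{-1/2}$ and $\overline{T_w}=(T_{w^{-1}})^{-1}$.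 The Kazhdan--Lusztig basis $\{C'_w\}$ is the unique basis with $\overline{C'_w}=C'_w$ and $q^{\ell(w)/2}C'_w=\sum_{v\le w}P_{v,w}(q)T_v$, where $P_{v,w}(q)\in\mathbb N[q]$ (the Kazhdan--Lusztig polynomials) have constant term $1$, $P_{w,w}=1$, and $\deg P_{v,w}<\frac{\ell(w)-\ell(v)-1}{2}$ for $v<w$. Set $\widetilde C_w(q)=q^{\ell(w)/2}C'_w$. For a sequence of intervals $\mathcal A=([a_1,b_1],\dots,[a_m,b_m])$ define, for $i<j$, $I_{i,j}=([a_i,b_i]\cap[a_j,b_j])\setminus([a_{i+1},b_{i+1}]\cup\cdots\cup[a_{j-1},b_{j-1}])$, and $f_{\mathcal A}(q)=\prod_{i<j}[\,|I_{i,j}|\,]_q!$, where $[p]_q=1+q+\cdots+q^{p-1}$ for $p>0$, $[p]_q!=[1]_q\cdots[p]_q$ and $[0]_q!=1$.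
   Formalization: Two misprints are corrected: for s_iw<w the relation is T_{s_i}T_w=(q-1)T_w+qT_{s_iw} (as printed T_s is not invertible), and the degree bound is deg P_{v,w} ≤ (ℓ(w)-ℓ(v)-1)/2 (the strict one contradicts constant term 1 when ℓ(w)=ℓ(v)+1). *)

(* Defs.v *)
From HB Require Import structures.
From mathcomp Require Import all_boot all_order all_algebra all_fingroup.
From mathcomp Require Import generic_quotient boolp.
From mathcomp Require Import zify.

Set Implicit Arguments.
Unset Strict Implicit.
Unset Printing Implicit Defensive.

Import Order.TTheory GRing.Theory Num.Theory.

Local Open Scope ring_scope.

(* Permutations of [n] are elements of 'S_n; positions and letters are shifted
   to 0, ..., n-1, and the one-line notation of w is w 0, w 1, ..., w (n-1).
   Since (u * v) k = v (u k), left multiplication by a simple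
   transposition swaps adjacent positions. With the opposite convention for
   products the Hecke algebra below becomes its opposite algebra, with the same
   basis (T_w), the same Bruhat order and the same Kazhdan-Lusztig basis. *)

Section Coxeter.
Variable n : nat.
Implicit Types (w u v : 'S_n) (i j : 'I_n.-1).

Lemma hi_subproof i : (i.+1 < n)%N.
Proof. by rewrite -ltn_predRL. Qed.

Definition lo i : 'I_n := widen_ord (leq_pred n) i.
Definition hi i : 'I_n := Ordinal (hi_subproof i).
Definition sgen i : 'S_n := tperm (lo i) (hi i).

Definition wordprod (s : seq 'I_n.-1) : 'S_n := (\prod_(i <- s) sgen i)%g.

Definition inversions w : {set 'I_n * 'I_n} :=
  [set p : 'I_n * 'I_n | (p.1 < p.2)%N && (w p.2 < w p.1)%N].
Definition asc i w := (w (lo i) < w (hi i))%N.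

Lemma lo_neq_hi i : lo i != hi i.
Proof. by rewrite -val_eqE /= neq_ltn ltnSn. Qed.

Lemma sgenL i : sgen i (lo i) = hi i. Proof. exact: tpermL. Qed.
Lemma sgenR i : sgen i (hi i) = lo i. Proof. exact: tpermR. Qed.
Lemma sgenK i : (sgen i * sgen i = 1)%g. Proof. exact: tperm2. Qed.
Lemma sgenV i : ((sgen i)^-1 = sgen i)%g. Proof. exact: tpermV. Qed.
Lemma sgenKl i w : (sgen i * (sgen i * w) = w)%g.
Proof. by rewrite mulgA sgenK mul1g. Qed.
Lemma sgenKr i w : (w * sgen i * sgen i = w)%g.
Proof. by rewrite -mulgA sgenK mulg1. Qed.
Lemma sgen_invo i : involutive (sgen i).
Proof. exact: tpermK. Qed.

Lemma asc_sgen i w : asc i (sgen i * w)%g = ~~ asc i w.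
Proof.
rewrite /asc !permM sgenL sgenR -leqNgt ltn_neqAle.
by rewrite (inj_eq val_inj) (inj_eq perm_inj) eq_sym lo_neq_hi.
Qed.

Lemma sgen_lt i (a b : 'I_n) : (a < b)%N ->
  (sgen i a < sgen i b)%N = ((a, b) != (lo i, hi i)).
Proof.
move=> ab; rewrite xpair_eqE negb_and.
case: (tpermP (lo i) (hi i) a) ab => [->|->|/eqP + /eqP +];
  case: (tpermP (lo i) (hi i) b) => [->|->|/eqP + /eqP +];
  rewrite -?val_eqE /=; lia.
Qed.

Lemma inversions_sgen i w : asc i w ->
  inversions (sgen i * w)%g =
    (lo i, hi i) |: [set (sgen i p.1, sgen i p.2) | p in inversions w].
Proof.
move=> aw; apply/setP=> -[a b]; rewrite !inE /= !permM.
case: (ltnP a b) => ab /=; last first.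
  apply/esym/negbTE; rewrite negb_or; apply/andP; split.
    by apply: contraTN ab => /eqP[-> ->]; rewrite -ltnNge /=.
  apply/imsetP => -[[c d]]; rewrite inE /= => /andP[cd wdc] [ea eb].
  move: ab; rewrite ea eb leqNgt sgen_lt // negbK => /eqP[ec ed].
  by move: wdc aw; rewrite ec ed /asc => /ltnW; rewrite leqNgt => /negPf->.
case: eqVneq => [[-> ->]|ne] /=; first by rewrite sgenL sgenR.
apply/idP/imsetP => [wab|[[c d]]].
  exists (sgen i a, sgen i b); last by rewrite /= !sgen_invo.
  by rewrite inE /= sgen_lt // ne.
rewrite inE /= => /andP[_ wdc] [-> ->].
by rewrite !sgen_invo.
Qed.

Lemma card_inversions_asc i w : asc i w ->
  #|inversions (sgen i * w)%g| = #|inversions w|.+1.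
Proof.
move=> aw; rewrite inversions_sgen // cardsU1 card_imset; last first.
  by move=> [a b] [c d] [/perm_inj -> /perm_inj ->].
rewrite [X in (~~ X + _)%N](_ : _ = false) //; apply/negbTE/imsetP.
move=> -[[c d]]; rewrite inE /= => /andP[cd _] [ec ed].
have := sgen_invo i c; have := sgen_invo i d; rewrite -ec -ed sgenL sgenR.
by move=> ed' ec'; move: cd; rewrite -ed' -ec' /= ltnNge leqnSn.
Qed.

Lemma card_inversions_desc i w : ~~ asc i w ->
  #|inversions w| = #|inversions (sgen i * w)%g|.+1.
Proof.
by move=> dw; rewrite -(@card_inversions_asc i) ?sgenKl // asc_sgen.
Qed.

Lemma all_asc w : (forall i, asc i w) -> w = 1%g.
Proof.
move=> aw.
have le k (kn : (k < n)%N) : (k <= w (Ordinal kn))%N.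
  elim: k kn => // k IH kn.
  have kn1 : (k < n.-1)%N by rewrite ltn_predRL.
  have := aw (Ordinal kn1); rewrite /asc.
  rewrite (_ : lo _ = Ordinal (ltnW kn)); last exact: val_inj.
  rewrite (_ : hi _ = Ordinal kn); last exact: val_inj.
  exact: leq_ltn_trans.
have lef (k : 'I_n) : predT k -> (k <= w k ?= iff (w k == k))%N.
  move=> _; split; last by rewrite eq_sym.
  by have := le k (ltn_ord k); rewrite (_ : Ordinal _ = k) //; apply: val_inj.
have [_] := leqif_sum lef.
rewrite [X in _ == X](_ : _ = \sum_(k < n) k)%N; last first.
  by rewrite [RHS](reindex_inj (@perm_inj _ w)).
rewrite eqxx => /esym/forallP h.
by apply/permP=> k; rewrite perm1; apply/eqP; exact: h.
Qed.

Lemma word_exists w :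
  exists2 s : seq 'I_n.-1, size s = #|inversions w| & wordprod s = w.
Proof.
move: {2}#|_| (erefl #|inversions w|) => k.
elim: k w => [|k IH] w kE.
  exists [::]; first by rewrite kE.
  rewrite /wordprod big_nil; apply/esym/all_asc => i.
  by apply: contraT => /card_inversions_desc; rewrite kE.
have /existsP[i di] : [exists i, ~~ asc i w].
  apply: contraPT kE; rewrite negb_exists => /forallP aw.
  have -> : w = 1%g by apply: all_asc => i; have := aw i; rewrite negbK.
  rewrite (_ : inversions 1 = set0) ?cards0 //; apply/setP=> -[a b].
  by rewrite !inE !perm1 /=; case: ltngtP.
have := card_inversions_desc di; rewrite kE => -[/esym kE'].
have [s ss sw] := IH _ kE'.
exists (i :: s); first by rewrite /= ss kE'.
by rewrite /wordprod big_cons -/(wordprod s) sw sgenKl.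
Qed.

Lemma inversions_word (s : seq 'I_n.-1) :
  (#|inversions (wordprod s)| <= size s)%N.
Proof.
elim: s => [|i s IH] /=; rewrite /wordprod.
  rewrite big_nil (_ : inversions 1 = set0) ?cards0 //; apply/setP=> -[a b].
  by rewrite !inE !perm1 /=; case: ltngtP.
rewrite big_cons -/(wordprod s); case: (boolP (asc i (wordprod s))) => a.
  by rewrite card_inversions_asc.
by apply: (leq_trans _ (leqW IH)); rewrite (card_inversions_desc a).
Qed.

Lemma len_subproof w :
  exists k, [exists s : k.-tuple 'I_n.-1, wordprod s == w].
Proof.
have [s _ sw] := word_exists w.
by exists (size s); apply/existsP; exists (in_tuple s); apply/eqP.
Qed.

Definition len w : nat := ex_minn (len_subproof w).

Lemma lenE w : len w = #|inversions w|.
Proof.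
rewrite /len; case: ex_minnP => k /existsP[s /eqP sw] kmin.
apply/eqP; rewrite eqn_leq; apply/andP; split.
  have [t st tw] := word_exists w; rewrite -st; apply: kmin.
  by apply/existsP; exists (in_tuple t); apply/eqP.
by rewrite -(size_tuple s) -[in X in (X <= _)%N]sw inversions_word.
Qed.

Lemma redword_subproof w :
  exists s : seq 'I_n.-1, (size s == len w) && (wordprod s == w).
Proof.
have [s ss sw] := word_exists w.
by exists s; rewrite lenE ss sw !eqxx.
Qed.

Definition redword w : seq 'I_n.-1 := xchoose (redword_subproof w).

Lemma size_redword w : size (redword w) = len w.
Proof. by have /andP[/eqP] := xchooseP (redword_subproof w). Qed.

Lemma redwordK w : wordprod (redword w) = w.
Proof. by have /andP[_ /eqP] := xchooseP (redword_subproof w). Qed.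

Definition bruhat_step v w :=
  [exists a : 'I_n, exists b : 'I_n,
    (w == tperm a b * v)%g && (len v < len w)%N].
Definition bruhat v w : bool := connect bruhat_step v w.
Definition bruhat_lt v w : bool := (v != w) && bruhat v w.

Lemma bruhat_len v w : bruhat v w -> (len v <= len w)%N.
Proof.
move=> /connectP[p]; elim: p v => [|u p IH] v /=; first by move=> _ ->.
move=> /andP[/existsP[a /existsP[b /andP[_ vu]]] pu] wE.
exact: leq_trans (ltnW vu) (IH _ pu wE).
Qed.

Lemma bruhat_lt_sgen i w : bruhat_lt w (sgen i * w)%g = asc i w.
Proof.
case: (boolP (asc i w)) => a.
  have lt : (len w < len (sgen i * w)%g)%N.
    by rewrite !lenE card_inversions_asc.
  rewrite /bruhat_lt; apply/andP; split.
    by apply: contraTneq lt => <-; rewrite ltnn.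
  apply: connect1; apply/existsP; exists (lo i); apply/existsP; exists (hi i).
  by rewrite eqxx.
apply/negbTE; apply: contra a => /andP[_ /bruhat_len].
by rewrite !lenE; case: (boolP (asc i w)) => // /card_inversions_desc ->;
  rewrite ltnn.
Qed.

End Coxeter.

(* H_n over an arbitrary commutative ring R and parameter q: an element h is
   the sum of the (h w) *: T w; see heckeE. *)
Definition hecke (R : comNzRingType) (q : R) (n : nat) : Type :=
  {ffun 'S_n -> R^o}.

HB.instance Definition _ (R : comNzRingType) (q : R) (n : nat) :=
  GRing.Lmodule.copy (hecke q n) {ffun 'S_n -> R^o}.

Section Hecke.
Variables (R : comNzRingType) (q : R) (n : nat).
Local Notation H := (hecke q n).
Implicit Types (x y z : H) (w u v : 'S_n) (i j : 'I_n.-1).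

Definition hcoef w x : R := (x : {ffun 'S_n -> R^o}) w.
Definition T w : H := [ffun v => (v == w)%:R] : {ffun 'S_n -> R^o}.

Lemma hcoefP x y : (forall w, hcoef w x = hcoef w y) <-> x = y.
Proof. by split=> [h|-> //]; apply/ffunP. Qed.

Lemma hcoef_T w v : hcoef v (T w) = (v == w)%:R.
Proof. by rewrite /hcoef ffunE. Qed.

Lemma hcoef_is_linear w : linear_for *%R (hcoef w).
Proof. by move=> a x y; rewrite /hcoef !ffunE. Qed.
HB.instance Definition _ w :=
  GRing.isLinear.Build R H R *%R (hcoef w) (hcoef_is_linear w).

Lemma heckeE x : x = \sum_w hcoef w x *: T w.
Proof.
apply/hcoefP => v; rewrite (raddf_sum (hcoef v)) (bigD1 v) //=.
rewrite (linearZ_LR (hcoef v)) /= hcoef_T eqxx mulr1 big1 ?addr0 //.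
move=> w wv; rewrite (linearZ_LR (hcoef v)) /= hcoef_T.
by rewrite eq_sym (negPf wv) mulr0.
Qed.

(* T_{s_i} T_w; the quadratic relation is T_s^2 = (q-1) T_s + q. *)
Definition sgenT i w : H :=
  if bruhat_lt w (sgen i * w)%g then T (sgen i * w)%g
  else (q - 1) *: T w + q *: T (sgen i * w)%g.

Definition lmul_gen i x : H := \sum_w hcoef w x *: sgenT i w.

Definition hmul x y : H :=
  \sum_w hcoef w x *: foldr lmul_gen y (redword w).

(* Right multiplication by T_{s_j}, only used to prove associativity. *)
Definition Tsgen j w : H :=
  if asc j w^-1%g then T (w * sgen j)%g
  else (q - 1) *: T w + q *: T (w * sgen j)%g.
Definition rmul_gen j x : H := \sum_w hcoef w x *: Tsgen j w.

Lemma extend_linear (f : 'S_n -> H) : linear (fun x => \sum_w hcoef w x *: f w).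
Proof.
move=> a x y; rewrite scaler_sumr -big_split /=; apply: eq_bigr => w _.
by rewrite (linearP (hcoef w)) /= scalerDl scalerA.
Qed.
HB.instance Definition _ i :=
  GRing.isLinear.Build R H H *:%R (lmul_gen i) (extend_linear (sgenT i)).
HB.instance Definition _ j :=
  GRing.isLinear.Build R H H *:%R (rmul_gen j) (extend_linear (Tsgen j)).

Lemma extend_T (f : 'S_n -> H) v : \sum_w hcoef w (T v) *: f w = f v.
Proof.
rewrite (bigD1 v) //= hcoef_T eqxx scale1r big1 ?addr0 // => w wv.
by rewrite hcoef_T (negPf wv) scale0r.
Qed.

Lemma lmul_genT i w : lmul_gen i (T w) = sgenT i w.
Proof. exact: extend_T. Qed.
Lemma rmul_genT j w : rmul_gen j (T w) = Tsgen j w.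
Proof. exact: extend_T. Qed.

Lemma sgenTE i w : sgenT i w = if asc i w then T (sgen i * w)%g
  else (q - 1) *: T w + q *: T (sgen i * w)%g.
Proof. by rewrite /sgenT bruhat_lt_sgen. Qed.

Lemma asc_mulr i j w : (sgen i * w != w * sgen j)%g ->
  asc i (w * sgen j)%g = asc i w.
Proof.
move=> ne; rewrite /asc !permM.
have key (a b : 'I_n) : (a < b)%N ->
    (forall c d, (c, d) = (lo i, hi i) \/ (c, d) = (hi i, lo i) ->
       w c = a -> w d = b -> (sgen j a < sgen j b)%N).
  move=> ab c d cd ca db; rewrite sgen_lt //; apply: contra ne => /eqP[ea eb].
  have -> : sgen i = tperm c d by case: cd => -[-> ->] //; rewrite tpermC.
  apply/eqP/permP=> k; rewrite !permM inj_tperm; last exact: perm_inj.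
  by rewrite ca db ea eb.
have := lo_neq_hi i; rewrite -(inj_eq (@perm_inj _ w)) -val_eqE neq_ltn.
case/orP=> h.
  by rewrite h (key _ _ h (lo i) (hi i)) //; left.
by rewrite !ltnNge !(ltnW h) ltnW // (key _ _ h (hi i) (lo i)) //; right.
Qed.

Lemma ascV_mull i j w : (sgen i * w != w * sgen j)%g ->
  asc j (sgen i * w)^-1%g = asc j w^-1%g.
Proof.
move=> ne; rewrite invMg sgenV asc_mulr //; apply: contra ne => /eqP e.
by apply/eqP/invg_inj; rewrite !invMg !sgenV e.
Qed.

Lemma ascV_sgen j w : asc j (w * sgen j)^-1%g = ~~ asc j w^-1%g.
Proof. by rewrite invMg sgenV asc_sgen. Qed.

Lemma asc_ascV i j w : (sgen i * w = w * sgen j)%g -> asc j w^-1%g = asc i w.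
Proof.
move=> /permP e; have := e (lo i); rewrite !permM sgenL => whi.
have : sgen j (w (lo i)) != w (lo i).
  by rewrite -whi (inj_eq perm_inj) eq_sym lo_neq_hi.
case: (tpermP (lo j) (hi j) (w (lo i))) => [wlo|wlo|]; last by rewrite eqxx.
- move: whi; rewrite wlo sgenL => whi _.
  by rewrite /asc -{1}wlo -whi !permK wlo whi /= !ltnSn.
move: whi; rewrite wlo sgenR => whi _.
by rewrite /asc -{1}whi -wlo !permK wlo whi /= !ltnNge !leqnSn.
Qed.

Lemma hecke_ext (f g : {linear H -> H}) :
  (forall w, f (T w) = g (T w)) -> f =1 g.
Proof.
move=> fg x; rewrite (heckeE x) !linear_sum; apply: eq_bigr => w _.
by rewrite !linearZ fg.
Qed.

Lemma lmul_rmul i j x :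
  lmul_gen i (rmul_gen j x) = rmul_gen j (lmul_gen i x).
Proof.
apply: (hecke_ext (f := lmul_gen i \o rmul_gen j)
                  (g := rmul_gen j \o lmul_gen i)) => w /=.
rewrite rmul_genT lmul_genT sgenTE /Tsgen.
case: (eqVneq (sgen i * w)%g (w * sgen j)%g) => [e|ne].
  have a1 : asc j (sgen i * w)^-1%g = ~~ asc i w.
    by rewrite e ascV_sgen (asc_ascV e).
  have a2 := asc_sgen i w.
  have e2 : (sgen i * w * sgen j = w)%g by rewrite e sgenKr.
  rewrite (asc_ascV e) -e; case: ifP => a.
    by rewrite lmul_genT rmul_genT sgenTE /Tsgen a1 a2 a sgenKl e2.
  rewrite (linearD (lmul_gen i)) (linearD (rmul_gen j)).
  rewrite !(linearZ_LR (lmul_gen i)) !(linearZ_LR (rmul_gen j)) /=.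
  by rewrite !lmul_genT !rmul_genT !sgenTE /Tsgen a1 a2 (asc_ascV e) a /= -e
    sgenKl e2.
have a1 := asc_mulr ne; have a2 := ascV_mull ne.
have lD := (linearD (lmul_gen i), linearD (rmul_gen j)).
have lZ := (linearZ_LR (lmul_gen i), linearZ_LR (rmul_gen j)).
case: ifP => aj; case: ifP => ai; rewrite ?lD ?lZ /=
  ?lmul_genT ?rmul_genT ?sgenTE /Tsgen ?a1 ?a2 ?ai ?aj ?mulgA //=.
by rewrite !scalerDr !scalerA [q * (q - 1)]mulrC addrACA.
Qed.

Lemma lmul_word_linear (s : seq 'I_n.-1) :
  linear (fun x => foldr lmul_gen x s).
Proof.
by move=> a x y; elim: s => //= i s ->; rewrite linearP.
Qed.

Lemma hmul_linear_l y : linear (hmul^~ y).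
Proof. exact: extend_linear. Qed.
Lemma hmul_linear_r x : linear (hmul x).
Proof.
move=> a y z; rewrite /hmul scaler_sumr -big_split /=; apply: eq_bigr => w _.
by rewrite lmul_word_linear scalerDr !scalerA mulrC.
Qed.
HB.instance Definition _ x :=
  GRing.isLinear.Build R H H *:%R (hmul x) (hmul_linear_r x).

Lemma hmulT w y : hmul (T w) y = foldr lmul_gen y (redword w).
Proof. exact: extend_T. Qed.

Lemma hmul_rmul j x y : hmul x (rmul_gen j y) = rmul_gen j (hmul x y).
Proof.
rewrite /hmul linear_sum; apply: eq_bigr => w _; rewrite linearZ /=.
by congr (_ *: _); elim: (redword w) => //= i s ->; rewrite lmul_rmul.
Qed.

Lemma rmul_gen_ext (f g : {linear H -> H}) :
    (forall j x, f (rmul_gen j x) = rmul_gen j (f x)) ->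
    (forall j x, g (rmul_gen j x) = rmul_gen j (g x)) ->
  f (T 1) = g (T 1) -> f =1 g.
Proof.
move=> fR gR fg; apply: hecke_ext => w.
move: {2}#|_| (erefl #|inversions w^-1%g|) => k.
elim: k w => [|k IH] w kE.
  suff -> : w = 1%g by [].
  apply: invg_inj; rewrite invg1; apply: all_asc => i.
  by apply: contraT => /card_inversions_desc; rewrite kE.
have [->//|w1] := eqVneq w 1%g.
have /existsP[j dj] : [exists j, ~~ asc j w^-1%g].
  apply: contraNT w1; rewrite negb_exists => /forallP aw.
  apply/eqP/invg_inj; rewrite invg1; apply: all_asc => i.
  by have := aw i; rewrite negbK.
have := card_inversions_desc dj; rewrite kE => -[/esym kE'].
have <- : rmul_gen j (T (w * sgen j)%g) = T w.
  by rewrite rmul_genT /Tsgen ascV_sgen dj sgenKr.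
by rewrite fR gR IH // invMg sgenV.
Qed.

Lemma lmul_reduced s : #|inversions (wordprod s)| = size s ->
  foldr lmul_gen (T 1) s = T (wordprod s).
Proof.
elim: s => [|i s IH]; first by rewrite /wordprod big_nil.
rewrite /wordprod big_cons -/(wordprod s) /= => ss.
have le := inversions_word s.
case: (boolP (asc i (wordprod s))) => a; last first.
  by have := card_inversions_desc a; move: le; rewrite ss; lia.
move: ss; rewrite card_inversions_asc // => -[/IH->].
by rewrite lmul_genT sgenTE a.
Qed.

Lemma hmul1r x : hmul x (T 1) = x.
Proof.
rewrite [RHS]heckeE; apply: eq_bigr => w _; congr (_ *: _).
by rewrite lmul_reduced ?redwordK // -lenE size_redword.
Qed.

Lemma len1 : len (1%g : 'S_n) = 0%N.
Proof.
apply/eqP; rewrite lenE cards_eq0; apply/eqP/setP => -[a b].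
by rewrite !inE !perm1 /=; case: ltngtP.
Qed.

Lemma hmul1l x : hmul (T 1) x = x.
Proof. by rewrite hmulT; have := size_redword (1%g : 'S_n); rewrite len1 => /size0nil->. Qed.

Lemma hmulA : associative hmul.
Proof.
move=> x y; apply: (rmul_gen_ext (f := hmul x \o hmul y)
                                 (g := hmul (hmul x y))) => [j z|j z|] /=.
- by rewrite !hmul_rmul.
- by rewrite hmul_rmul.
- by rewrite !hmul1r.
Qed.

Lemma hmulDl : left_distributive hmul +%R.
Proof.
by move=> x y z; have := hmul_linear_l z 1 x y; rewrite !scale1r.
Qed.

Lemma hmulDr : right_distributive hmul +%R.
Proof. by move=> x y z; rewrite linearD. Qed.

Lemma hT1_neq0 : T 1 != 0 :> H.
Proof.
apply/eqP => /(congr1 (hcoef 1%g)); rewrite hcoef_T eqxx /= raddf0.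
by apply/eqP; rewrite oner_eq0.
Qed.

HB.instance Definition _ := GRing.Zmodule_isNzRing.Build H
  hmulA hmul1l hmul1r hmulDl hmulDr hT1_neq0.

Lemma hecke_scalerAl (a : R) x y : a *: (x * y) = (a *: x) * y.
Proof.
have h := hmul_linear_l y a x 0; rewrite -[a *: x]addr0 [RHS]h.
by rewrite [X in _ = _ + X](mul0r (y : H)) addr0.
Qed.
HB.instance Definition _ := GRing.Lmodule_isLalgebra.Build R H hecke_scalerAl.

Lemma hecke_scalerAr (a : R) x y : a *: (x * y) = x * (a *: y).
Proof. by rewrite [RHS](linearZ_LR (hmul x)). Qed.
HB.instance Definition _ := GRing.Lalgebra_isAlgebra.Build R H hecke_scalerAr.

Lemma T1 : T 1 = 1. Proof. by []. Qed.

Lemma Tsgen_mul i x : T (sgen i) * x = lmul_gen i x.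
Proof.
apply: (rmul_gen_ext (f := hmul (T (sgen i))) (g := lmul_gen i)) => [j y|j y|].
- exact: hmul_rmul.
- exact: lmul_rmul.
rewrite [LHS]hmul1r /= lmul_genT sgenTE /asc !perm1 /= ltnSn.
by rewrite mulg1.
Qed.

Lemma TsgenM i w : T (sgen i) * T w =
  if bruhat_lt w (sgen i * w)%g then T (sgen i * w)%g
  else (q - 1) *: T w + q *: T (sgen i * w)%g.
Proof. by rewrite Tsgen_mul lmul_genT. Qed.

(* Two-sided inverses are chosen classically. *)
Definition hecke_unit : pred H :=
  fun x => `[< exists y, y * x = 1 /\ x * y = 1 >].

Definition hecke_inv x : H :=
  if pselect (exists y, y * x = 1 /\ x * y = 1) is left e
  then projT1 (cid e) else x.

Lemma hecke_mulVr : {in hecke_unit, left_inverse 1 hecke_inv *%R}.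
Proof.
move=> x /asboolP ux; rewrite /hecke_inv; case: pselect => // e.
by case: cid => y [].
Qed.
Lemma hecke_divrr : {in hecke_unit, right_inverse 1 hecke_inv *%R}.
Proof.
move=> x /asboolP ux; rewrite /hecke_inv; case: pselect => // e.
by case: cid => y [].
Qed.
Lemma hecke_unitP x y : y * x = 1 /\ x * y = 1 -> hecke_unit x.
Proof. by move=> xy; apply/asboolP; exists y. Qed.
Lemma hecke_inv_out : {in [predC hecke_unit], hecke_inv =1 id}.
Proof.
by move=> x /asboolP ux; rewrite /hecke_inv; case: pselect.
Qed.
HB.instance Definition _ := GRing.NzRing_hasMulInverse.Build H
  hecke_mulVr hecke_divrr hecke_unitP hecke_inv_out.

Lemma T_unit w : (exists q', q' * q = 1) -> T w \is a GRing.unit.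
Proof.
move=> [q' qq].
have us i : T (sgen i) \is a GRing.unit.
  have ss : T (sgen i) * T (sgen i) = (q - 1) *: T (sgen i) + q *: 1.
    rewrite TsgenM bruhat_lt_sgen /asc sgenL sgenR /= ltnNge leqnSn /=.
    by rewrite sgenK.
  apply/unitrP; exists (q' *: (T (sgen i) - (q - 1) *: 1)); split.
    rewrite -scalerAl mulrBl ss -scalerAl mul1r addrC addKr.
    by rewrite scalerA qq scale1r.
  rewrite -scalerAr mulrBr ss -scalerAr mulr1 addrC addKr.
  by rewrite scalerA qq scale1r.
have -> : T w = foldr (fun i x => T (sgen i) * x) 1 (redword w).
  rewrite -[LHS]hmul1r hmulT T1.
  by elim: (redword w) => //= i s ->; rewrite Tsgen_mul.
by elim: (redword w) => /= [|i s IH]; rewrite ?unitr1 // unitrMl.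
Qed.

End Hecke.

Arguments T {R q n} w.

(* The coefficient ring Z[q^{1/2}, q^{-1/2}], as a subring of the fraction field
   of Z[q^{1/2}]; the polynomial variable stands for q^{1/2}. *)
Notation ratfun := {fraction {poly int}}.
Definition qh_frac : ratfun := FracField.tofrac 'X.

Definition laurent_pred : {pred ratfun} := fun x =>
  `[< exists (p : {poly int}) (k : nat), x = FracField.tofrac p / qh_frac ^+ k >].

Lemma qh_frac_neq0 : qh_frac != 0.
Proof. by rewrite tofrac_eq0 polyX_eq0. Qed.

Lemma laurent_subring : subring_closed laurent_pred.
Proof.
split.
- by apply/asboolP; exists 1, 0%N; rewrite tofrac1 expr0 divr1.
- move=> x y /asboolP[p [k ->]] /asboolP[r [l ->]]; apply/asboolP.
  exists (p * 'X^l - r * 'X^k), (k + l)%N.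
  rewrite tofracB !tofracM !tofracXn -/qh_frac exprD.
  have a0 := expf_neq0 k qh_frac_neq0; have b0 := expf_neq0 l qh_frac_neq0.
  by rewrite mulrBl invfM mulrACA divff // mulr1 [_^-1 * _]mulrC mulrACA
    divff // mulr1.
- move=> x y /asboolP[p [k ->]] /asboolP[r [l ->]]; apply/asboolP.
  by exists (p * r), (k + l)%N; rewrite tofracM exprD invfM mulrACA.
Qed.
HB.instance Definition _ :=
  GRing.isSubringClosed.Build ratfun laurent_pred laurent_subring.

Record laurent : Type :=
  Laurent { laurent_val :> ratfun; laurentP : laurent_val \in laurent_pred }.
HB.instance Definition _ := [isSub for laurent_val].
HB.instance Definition _ := [Choice of laurent by <:].
HB.instance Definition _ := [SubChoice_isSubComNzRing of laurent by <:].

Lemma qh_subproof : qh_frac \in laurent_pred.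
Proof. by apply/asboolP; exists 'X, 0%N; rewrite expr0 divr1. Qed.
Lemma qhV_subproof : qh_frac^-1 \in laurent_pred.
Proof. by apply/asboolP; exists 1, 1%N; rewrite tofrac1 expr1 div1r. Qed.

(* qh and qhV are q^{1/2} and q^{-1/2}. *)
Definition qh : laurent := Laurent qh_subproof.
Definition qhV : laurent := Laurent qhV_subproof.
Definition q : laurent := qh ^+ 2.

Lemma qhK : qhV * qh = 1.
Proof. by apply: val_inj; rewrite rmorphM /= mulVf ?qh_frac_neq0. Qed.

(* Substitution of q^{-1/2} for q^{1/2}. *)
Definition subst_qhV (p : {poly int}) : ratfun :=
  (map_poly intr p).[qh_frac^-1].
Definition bar_frac (x : ratfun) : ratfun :=
  subst_qhV \n_(repr x) / subst_qhV \d_(repr x).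

HB.instance Definition _ := GRing.RMorphism.copy subst_qhV
  (horner_eval qh_frac^-1 \o map_poly intr).

Lemma subst_qhVE p : subst_qhV p * qh_frac ^+ (size p).-1 =
  FracField.tofrac (\sum_(i < size p) p`_i *: 'X^((size p).-1 - i)).
Proof.
rewrite /subst_qhV /map_poly horner_poly mulr_suml raddf_sum.
apply: eq_bigr => i _ /=; rewrite -mul_polyC tofracM tofracXn -/qh_frac.
rewrite -[in RHS](intz p`_i) !rmorph_int -mulrA; congr (_ * _).
have le : (i <= (size p).-1)%N by rewrite -ltnS (ltn_predK (ltn_ord i)).
rewrite -{1}(subnK le) exprD mulrCA exprVn mulVf ?mulr1 //.
exact: expf_neq0 qh_frac_neq0.
Qed.

Lemma subst_qhV_eq0 p : (subst_qhV p == 0) = (p == 0).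
Proof.
apply/eqP/eqP => [p0|->]; last exact: rmorph0.
have := subst_qhVE p; rewrite p0 mul0r => /esym/eqP.
rewrite tofrac_eq0 => /eqP r0; apply/eqP; apply: contra_eqT r0 => pn0.
apply/eqP => /(congr1 (fun r : {poly int} => r`_0)); rewrite coef0 coef_sum.
have sp : ((size p).-1 < size p)%N by rewrite prednK ?size_poly_gt0.
rewrite (bigD1 (Ordinal sp)) //= subnn coefZ coefXn eqxx mulr1 big1 ?addr0.
  by move/eqP; rewrite -/(lead_coef p) lead_coef_eq0 (negPf pn0).
move=> i ni; rewrite coefZ coefXn eq_sym subn_eq0.
suff /negPf-> : ~~ ((size p).-1 <= i)%N by rewrite mulr0.
apply: contra ni => le; rewrite -val_eqE /= eqn_leq le andbT.
by rewrite -ltnS (ltn_predK (ltn_ord i)).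
Qed.

Lemma fracE (x : ratfun) :
  x = FracField.tofrac \n_(repr x) / FracField.tofrac \d_(repr x).
Proof.
rewrite -[X in X = _]reprK; set r := repr x.
change (FracField.tofrac \n_r / FracField.tofrac \d_r) with
  (FracField.mul (FracField.tofrac \n_r) (FracField.inv (FracField.tofrac \d_r))).
rewrite !piE /FracField.mulf /FracField.invf.
rewrite !numden_Ratio ?oner_eq0 ?denom_ratioP //.
by rewrite mulr1 mul1r Ratio_numden.
Qed.

Lemma bar_fracE p r : r != 0 ->
  bar_frac (FracField.tofrac p / FracField.tofrac r) = subst_qhV p / subst_qhV r.
Proof.
move=> r0; rewrite /bar_frac; set x := FracField.tofrac p / _.
have d0 : \d_(repr x) != 0 by exact: denom_ratioP.
have := fracE x; rewrite {1}/x => /eqP.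
rewrite eqr_div ?tofrac_eq0 // -!tofracM tofrac_eq => /eqP e.
by apply/eqP; rewrite eqr_div ?subst_qhV_eq0 // -!rmorphM e.
Qed.

Lemma subst_qhVX : subst_qhV 'X = qh_frac^-1.
Proof. by rewrite /subst_qhV map_polyX hornerX. Qed.

Lemma bar_subproof (x : laurent) : bar_frac (val x) \in laurent_pred.
Proof.
case: x => x /= /asboolP[p [k ->]].
rewrite -tofracXn bar_fracE ?expf_neq0 ?polyX_eq0 //.
rewrite rmorphXn /= subst_qhVX exprVn invrK; apply/asboolP.
exists ((\sum_(i < size p) p`_i *: 'X^((size p).-1 - i)) * 'X^k), (size p).-1.
rewrite tofracM tofracXn -subst_qhVE -/qh_frac mulrAC mulfK //.
exact: expf_neq0 qh_frac_neq0.
Qed.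

Definition bar_coef (x : laurent) : laurent := Laurent (bar_subproof x).

Lemma bar_frac_val (x : laurent) : val (bar_coef x) = bar_frac (val x).
Proof. by []. Qed.

Lemma bar_coef_is_zmod_morphism : zmod_morphism bar_coef.
Proof.
move=> x y; apply: val_inj; rewrite rmorphB /=.
rewrite [in LHS](fracE (\val x)) [in LHS](fracE (\val y)).
have dx := denom_ratioP (repr (\val x)); have dy := denom_ratioP (repr (\val y)).
rewrite -mulNr addf_div ?tofrac_eq0 // -tofracN -!tofracM -tofracD.
rewrite bar_fracE ?mulf_neq0 // !rmorphM rmorphD !rmorphM rmorphN.
by rewrite -addf_div ?subst_qhV_eq0 // mulNr.
Qed.
Lemma bar_coef_is_monoid_morphism : monoid_morphism bar_coef.
Proof.
split=> [|x y]; apply: val_inj; rewrite ?rmorph1 ?rmorphM /=.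
  rewrite -[X in bar_frac X]divr1 -tofrac1 bar_fracE ?oner_neq0 //.
  by rewrite !rmorph1 divr1.
rewrite [in LHS](fracE (\val x)) [in LHS](fracE (\val y)) mulf_div -!tofracM.
rewrite bar_fracE ?mulf_neq0 ?denom_ratioP // !rmorphM.
by rewrite -mulf_div.
Qed.
HB.instance Definition _ := GRing.isZmodMorphism.Build laurent laurent bar_coef
  bar_coef_is_zmod_morphism.
HB.instance Definition _ := GRing.isMonoidMorphism.Build laurent laurent bar_coef
  bar_coef_is_monoid_morphism.

Lemma bar_coef_qh : bar_coef qh = qhV.
Proof.
apply: val_inj => /=; rewrite -[X in bar_frac X]divr1 -tofrac1 bar_fracE ?oner_neq0 //.
by rewrite rmorph1 subst_qhVX divr1.
Qed.

Section KazhdanLusztig.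
Variable n : nat.
Local Notation H := (hecke q n).
Implicit Types (w v : 'S_n).

Lemma T_unitq w : (T w : H) \is a GRing.unit.
Proof. by apply: T_unit; exists (qhV ^+ 2); rewrite -exprMn qhK expr1n. Qed.

Definition bar (h : H) : H := \sum_w bar_coef (hcoef w h) *: (T w^-1)^-1.

(* P v w is the Kazhdan-Lusztig polynomial P_{v,w}, in the variable q; it is
   only constrained for v <= w. The degree bound is
   deg P_{v,w} <= (len w - len v - 1) / 2, where deg P = (size P).-1; the strict
   version is contradictory when len w = len v + 1. *)
Definition KL_basis (C : 'S_n -> H) : Prop :=
  exists P : 'S_n -> 'S_n -> {poly int},
    (forall w, bar (C w) = C w) /\
    (forall w, qh ^+ len w *: C w =
       \sum_(v | bruhat v w) (map_poly intr (P v w)).[q] *: T v) /\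
    (forall v w, bruhat v w -> P v w \is a polyOver Num.nneg) /\
    (forall v w, bruhat v w -> (P v w)`_0 = 1) /\
    (forall w, P w w = 1) /\
    (forall v w, bruhat_lt v w ->
       (2 * (size (P v w)).-1 <= len w - len v - 1)%N).

Definition KL_tilde (C : 'S_n -> H) w : H := qh ^+ len w *: C w.

End KazhdanLusztig.

Definition qint (p : nat) : laurent := \sum_(k < p) q ^+ k.
Definition qfact (p : nat) : laurent := \prod_(k < p) qint k.+1.

Section Reversals.
Variable n : nat.
Implicit Types (I : 'I_n * 'I_n) (k : 'I_n).

(* The pair (a, b) with a <= b stands for the interval [a, b]. *)
Definition in_itv I k := (I.1 <= k <= I.2)%N.
Definition itv_set I : {set 'I_n} := [set k | in_itv I k].

Definition rev_fun I k : 'I_n :=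
  if in_itv I k then insubd k (I.1 + I.2 - k)%N else k.

Lemma rev_funK I : involutive (rev_fun I).
Proof.
move=> k; rewrite {2}/rev_fun; case: ifP => h; last by rewrite /rev_fun h.
have lt : (I.1 + I.2 - k < n)%N.
  by case/andP: h => h1 h2; have := ltn_ord I.2; lia.
have vE : insubd k (I.1 + I.2 - k)%N = (I.1 + I.2 - k)%N :> nat.
  by rewrite -[LHS]/(val _) val_insubd lt.
rewrite /rev_fun.
have -> : in_itv I (insubd k (I.1 + I.2 - k)%N).
  by move: h; rewrite /in_itv vE; lia.
apply: val_inj; rewrite val_insubd vE.
have e : (I.1 + I.2 - (I.1 + I.2 - k))%N = k :> nat.
  by case/andP: h => h1 h2; lia.
by rewrite e ltn_ord.
Qed.

Definition reversal I : 'S_n := perm (can_inj (rev_funK I)).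

Variables (m : nat) (A : m.-tuple ('I_n * 'I_n)).

Definition overlap (i j : 'I_m) : {set 'I_n} :=
  (itv_set (tnth A i) :&: itv_set (tnth A j))
    :\: \bigcup_(k < m | (i < k < j)%N) itv_set (tnth A k).

Definition revfact_denom : laurent :=
  \prod_(i < m) \prod_(j < m | (i < j)%N) qfact #|overlap i j|.

End Reversals.

(* Extension of scalars from Z[q^{1/2}, q^{-1/2}] to its fraction field, where
   division by f_A makes sense. *)
Definition hecke_frac n (h : hecke q n) : hecke (val q) n :=
  \sum_w val (hcoef w h) *: T w.

Definition has_reversal_factorization n (C : 'S_n -> hecke q n) (w : 'S_n) :=
  exists (m : nat) (A : m.-tuple ('I_n * 'I_n)),
    (forall i, ((tnth A i).1 <= (tnth A i).2)%N) /\
    hecke_frac (KL_tilde C w) =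
      (val (revfact_denom A))^-1 *:
        hecke_frac (\prod_(i < m) KL_tilde C (reversal (tnth A i))).

(* Patterns are given by their one-line notation. *)
Definition pattern_at n k (p : k.-tuple nat) (w : 'S_n)
    (f : {ffun 'I_k -> 'I_n}) : bool :=
  [forall a : 'I_k, forall b : 'I_k, (a < b)%N ==>
     (f a < f b)%N && ((w (f a) < w (f b))%N == (tnth p a < tnth p b)%N)].

Definition avoids n k (p : k.-tuple nat) (w : 'S_n) : bool :=
  ~~ [exists f : {ffun 'I_k -> 'I_n}, pattern_at p w f].

Definition p4231 : 4.-tuple nat := [tuple 4; 2; 3; 1]%N.
Definition p3412 : 4.-tuple nat := [tuple 3; 4; 1; 2]%N.

(* The default value n exceeds every difference of letters, so for w containing
   3412 this is the minimum over all occurrences. *)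
Definition gap3412 n (w : 'S_n) : nat :=
  \big[minn/n]_(f : {ffun 'I_4 -> 'I_n} | pattern_at p3412 w f)
    (w (f ord0) - w (f ord_max))%N.

(* Main.v *)
(* Let N(w) be the number of Bruhat coatoms of w. The index representation sends
   the Kazhdan-Lusztig element of w to a palindromic polynomial 1 + N(w) q + ...,
   so comparing linear coefficients in a reversal factorization gives
     sum_j (|I_j| - 1) <= N(w) + sum_(i < j) (|I_(i,j)| - 1)^+,
   that is, N(w) is at least n minus the number of intervals (and of uncovered
   points) plus the number of edges of the graph in which i and j are joined when
   I_(i,j) is nonempty. On the other hand, if w avoids 4231 and gap_3412(w) > 1,
   the coatoms form a forest on the positions, and every labelling of positions
   that is constant along inversions has at most n - N(w) values.

   A factorization also exhibits w as a product u_1 ... u_m of elements of the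
   parabolic subgroups of the intervals, of maximal length among such products.
   Follow each letter through the product: by maximality, two letters pass through
   a common interval exactly when they are inverted. The four letters of an
   occurrence of 3412 then close up to a cycle in the graph above. Hence this graph
   has one more component than its number of edges forces, its components label the
   positions, and the two bounds on N(w) contradict each other. *)
From HB Require Import structures.
Require Import Defs.
From mathcomp Require Import all_boot all_order all_algebra all_fingroup.
From mathcomp Require Import zify.

Set Implicit Arguments.
Unset Strict Implicit.
Unset Printing Implicit Defensive.

Import Order.TTheory GRing.Theory Num.Theory.

Local Notation in_itv := Defs.in_itv.
Local Open Scope ring_scope.

(** * Lengths and coatoms *)

Section Length.
Variable n : nat.
Implicit Types (w v : 'S_n) (a b c i j : 'I_n).

Definition swap_pair a b (p : 'I_n * 'I_n) :=
  let t := tperm a b in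
  if (t p.1 < t p.2)%N then (t p.1, t p.2) else p.

(** The map [swap_pair a b], which moves a pair by the transposition unless that would reverse its
    order, injects the inversions of [w] into those of [tperm a b * w] and misses [(a, b)]. *)
Lemma len_tperm_asc w a b : (a < b)%N -> (w a < w b)%N ->
  (len w < len (tperm a b * w)%g)%N.
Proof.
move=> ab wab; set t := tperm a b; rewrite !lenE.
have tK : involutive t by exact: tpermK.
have inj : {in inversions w &, injective (swap_pair a b)}.
  move=> [i j] [k l]; rewrite !inE /= /swap_pair -/t /= => /andP[ij _] /andP[kl _].
  case: ifP => h1; case: ifP => h2 [e1 e2].
  - by rewrite (perm_inj e1) (perm_inj e2).
  - by move: h2; rewrite -e1 -e2 !tK ij.
  - by move: h1; rewrite e1 e2 !tK kl.
  - by rewrite e1 e2.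
rewrite -(card_in_imset inj); apply: proper_card.
apply/properP; split.
  apply/subsetP => _ /imsetP[[i j] + ->]; rewrite !inE /swap_pair -/t /=.
  case/andP=> ij wji; case: ifP => h /=; first by rewrite !permM !tK h wji.
  rewrite ij !permM; move: ij h wji; rewrite /t.
  case: (tpermP a b i) => [->|->|/eqP ia /eqP ib];
    case: (tpermP a b j) => [->|->|/eqP ja /eqP jb]; move=> ij *; rewrite ?ij /=; lia.
exists (a, b); first by rewrite inE /= ab !permM /t tpermL tpermR.
apply/imsetP => -[[i j]]; rewrite inE /= /swap_pair -/t /= => /andP[ij wji].
case: ifP => h [ea eb].
  have := congr1 t ea; have := congr1 t eb; rewrite !tK /t tpermL tpermR.
  by move=> ej ei; move: ij; rewrite -ej -ei; lia.
by move: wji; rewrite -ea -eb; lia.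
Qed.

Lemma len_tperm_desc w a b : (a < b)%N -> (w b < w a)%N ->
  (len (tperm a b * w)%g < len w)%N.
Proof.
move=> ab wab; rewrite -[X in (_ < len X)%N](mul1g w) -(tperm2 a b) -mulgA.
by apply: len_tperm_asc; rewrite // !permM tpermL tpermR.
Qed.

Lemma len_tperm_lt w a b : (a < b)%N ->
  (len (tperm a b * w)%g < len w)%N -> (w b < w a)%N.
Proof.
move=> ab; apply: contraTT; rewrite -!leqNgt leq_eqVlt.
rewrite (inj_eq val_inj) (inj_eq perm_inj) => /orP[/eqP e|wab].
  by move: ab; rewrite e ltnn.
exact/ltnW/len_tperm_asc.
Qed.

(** Writing [tperm a b] as [tperm a c * tperm c b * tperm a c], each of the three factors in turn
    lowers the length. *)
Lemma len_tperm_between w a b c : (a < c < b)%N -> (w b < w c < w a)%N ->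
  (len (tperm a b * w)%g).+1 != len w.
Proof.
move=> /andP[ac cb] /andP[wbc wca].
have neq (x y : 'I_n) : (x < y)%N -> x == y = false.
  by move=> xy; apply/eqP => e; move: xy; rewrite e ltnn.
have nac := neq _ _ ac; have ncb := neq _ _ cb; have nab := neq _ _ (ltn_trans ac cb).
have -> : tperm a b = (tperm a c * tperm c b * tperm a c)%g.
  have e : tperm a c b = b by rewrite tpermD ?nab // ncb.
  have := tpermJ c b (tperm a c); rewrite conjgE tpermV tpermR e => <-.
  by rewrite mulgA.
rewrite -!mulgA.
have h1 : (len (tperm a c * w)%g < len w)%N by apply: len_tperm_desc.
set v := (tperm a c * w)%g in h1 *.
have h2 : (len (tperm c b * v)%g < len v)%N.
  apply: len_tperm_desc => //; rewrite !permM tpermR tpermD ?nab ?ncb ?nac //.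
  exact: ltn_trans wca.
set u := (tperm c b * v)%g in h2 *.
have h3 : (len (tperm a c * u)%g < len u)%N.
  apply: len_tperm_desc => //.
  have -> : u c = w b by rewrite !permM tpermL tpermD ?nab ?ncb.
  have e2 : tperm c b a = a by rewrite tpermD // eq_sym ?nac ?nab.
  by have -> : u a = w c by rewrite !permM e2 tpermL.
rewrite neq_ltn; apply/orP; left.
exact: leq_ltn_trans (ltn_trans h3 h2) h1.
Qed.

Lemma len_inv w : len w^-1%g = len w.
Proof.
rewrite !lenE -(card_imset (inversions w) (f := fun p => (w p.2, w p.1))).
  apply: eq_card => -[i j]; rewrite inE /=; apply/idP/imsetP.
    by move=> /andP[ij wji]; exists (w^-1 j, w^-1 i)%g; rewrite ?inE /= ?permKV ?wji.
  by case=> -[k l]; rewrite inE /= => /andP[kl wlk] [-> ->]; rewrite !permK wlk kl.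
by move=> [i j] [k l] /= [/perm_inj -> /perm_inj ->].
Qed.

Lemma bruhat_lt_len v w : bruhat_lt v w -> (len v < len w)%N.
Proof.
case/andP=> vw /connectP[[|u p] /=]; first by move=> _ e; rewrite e eqxx in vw.
case/andP=> /existsP[a /existsP[b /andP[_ vu]]] up wE.
by apply: leq_trans vu _; apply: bruhat_len; apply/connectP; exists p.
Qed.

Definition coatoms w : {set 'S_n} :=
  [set v | bruhat_lt v w && ((len v).+1 == len w)].

(** Inversions whose rectangle in the diagram of [w] has no point strictly inside: the candidates
    for transpositions leading to coatoms. *)
Definition covers w : {set 'I_n * 'I_n} :=
  [set p : 'I_n * 'I_n | [&& (p.1 < p.2)%N, (w p.2 < w p.1)%N &
    [forall c : 'I_n, ~~ ((p.1 < c < p.2) && (w p.2 < w c < w p.1))%N]]].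

Lemma bruhat_stepP v w : bruhat_step v w ->
  exists a b, [/\ (a < b)%N, (w b < w a)%N & v = (tperm a b * w)%g].
Proof.
case/existsP=> a /existsP[b /andP[/eqP wE lt]].
have vE : v = (tperm a b * w)%g by rewrite wE mulgA tperm2 mul1g.
have := lt; rewrite {1}vE; case: (ltngtP a b) => [ab|ba|/val_inj ->].
- by move=> h; exists a, b; split=> //; apply: len_tperm_lt h.
- by rewrite tpermC => h; exists b, a; split; rewrite // 1?tpermC //; apply: len_tperm_lt h.
- by rewrite tperm1 mul1g ltnn.
Qed.

Lemma card_coatoms_le w : (#|coatoms w| <= #|covers w|)%N.
Proof.
apply: leq_trans (leq_imset_card (fun p : 'I_n * 'I_n => tperm p.1 p.2 * w)%g _).
apply/subset_leq_card/subsetP => v; rewrite inE => /andP[/andP[vw le] /eqP lv].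
have st : bruhat_step v w.
  case/connectP: le => -[|u p] /=; first by move=> _ e; rewrite e eqxx in vw.
  case/andP=> vu up wE; suff <- : u = w by [].
  (* Each Bruhat step raises the length, so a chain from a coatom to [w] has a single step. *)
  apply/eqP; apply: contraT => uw; have [a [b [ab _ vE]]] := bruhat_stepP vu.
  have uw' : bruhat_lt u w by rewrite /bruhat_lt uw; apply/connectP; exists p.
  have := bruhat_lt_len uw'; have /existsP[? /existsP[? /andP[_]]] := vu.
  by rewrite -lv; lia.
have [a [b [ab wba vE]]] := bruhat_stepP st.
apply/imsetP; exists (a, b) => //; rewrite inE /= ab wba /=.
apply/forallP => c; apply/negP => /andP[acb wbca].
by move: (len_tperm_between acb wbca); rewrite -vE lv eqxx.
Qed.

End Length.

(** * The forest of covers *)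

(* In every set S of cover pairs, the pair joining the highest letter b to its last
   neighbour c is a bridge: it is the only one leaving the set X of letters that
   are larger than, and to the right of, all other neighbours of b. *)
Lemma forest_covers n (w : 'S_n) (K : finType) (kap : 'I_n -> K)
    (S : {set 'I_n * 'I_n}) :
    (forall a b c d : 'I_n, (a < b < c)%N -> (c < d)%N ->
       (w d < w b < w c)%N -> (w c < w a)%N -> False) ->
    (forall b c l x : 'I_n, (b, c) \in covers w -> (l < b)%N -> (c < x)%N ->
       (w c < w x < w l)%N -> (w l < w b)%N -> False) ->
    S \subset covers w -> (forall i j, (i, j) \in S -> kap i = kap j) ->
  (#|S| + #|[set kap i | i : 'I_n]| <= n)%N.
Proof.
move=> no4231 no3412; move: {2}#|S| (leqnn #|S|) => k.
elim: k K kap S => [|k IH] K kap S.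
  rewrite leqn0 => /eqP-> _ _; rewrite add0n.
  by apply: leq_trans (leq_imset_card _ _) _; rewrite card_ord.
case: (set_0Vmem S) => [-> _ _ _|[p0 p0S] Sk SC kapS].
  rewrite cards0 add0n; apply: leq_trans (leq_imset_card _ _) _.
  by rewrite card_ord.
have SP (i j : 'I_n) : (i, j) \in S -> (i < j)%N && (w j < w i)%N.
  by move=> /(subsetP SC); rewrite inE /= => /and3P[-> ->].
have empty (i j x : 'I_n) : (i, j) \in S -> (i < x < j)%N -> ~~ (w j < w x < w i)%N.
  move=> /(subsetP SC); rewrite inE /= => /and3P[_ _ /forallP/(_ x)].
  by move=> + h; rewrite h.
case: (arg_maxnP (fun p : 'I_n * 'I_n => w p.1) p0S) => -[b c0] bS bmax.
have {}bS : (b, c0) \in S by [].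
case: (@arg_maxnP _ (b, c0) [pred p in S | p.1 == b]
         (fun p : 'I_n * 'I_n => p.2)) => [|[b' c]]; first by rewrite inE /= bS eqxx.
case/andP=> /= bcS /eqP b'E cmax; rewrite {b'}b'E in bcS.
have top (i j : 'I_n) : (i, j) \in S -> (w i <= w b)%N by move=> /bmax.
have last (j : 'I_n) : (b, j) \in S -> (j <= c)%N.
  by move=> bjS; have := cmax (b, j); rewrite /= bjS eqxx; apply.
have [bc wcb] : (b < c)%N /\ (w c < w b)%N by apply/andP/SP.
pose X := [set i : 'I_n | (i != b) &&
  [forall d : 'I_n, ((b, d) \in S) && (d != c) ==> (d < i)%N && (w d < w i)%N]].
have XP (i d : 'I_n) : i \in X -> (b, d) \in S -> d <> c -> (d < i)%N /\ (w d < w i)%N.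
  rewrite inE => /andP[_ /forallP/(_ d)] + bd /eqP dc.
  by rewrite bd dc => /andP[].
have bX : b \notin X by rewrite inE eqxx.
have cX : c \in X.
  rewrite inE; apply/andP; split; first by apply/eqP => e; move: bc; rewrite e ltnn.
  apply/forallP => d; apply/implyP => /andP[bd /eqP dc].
  have dltc : (d < c)%N.
    by have := last _ bd; rewrite leq_eqVlt => /orP[/eqP/val_inj|].
  rewrite dltc /=; have /andP[bd' wdb] := SP _ _ bd.
  have := empty _ _ d bcS; rewrite bd' dltc wdb => /(_ isT).
  rewrite andbT -leqNgt.
  rewrite leq_eqVlt => /orP[/eqP/val_inj/perm_inj|//].
  by move=> /dc.
have Xclosed (i j : 'I_n) : (i, j) \in S :\ (b, c) -> (i \in X) = (j \in X).
  rewrite in_setD1 => /andP[ne ijS]; have /andP[ij wji] := SP _ _ ijS.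
  have [ib|/eqP ib] := eqVneq i b.
    rewrite ib (negPf bX); apply/esym/negbTE/negP => jX.
    have jc : j <> c by move=> e; rewrite ib e eqxx in ne.
    by rewrite ib in ijS; have [] := XP _ _ jX ijS jc; rewrite ltnn.
  have jb : j <> b by move=> e; move: wji; rewrite e ltnNge (top _ _ ijS).
  have wib : (w i < w b)%N.
    by rewrite ltn_neqAle (top _ _ ijS) andbT; apply/eqP => /val_inj/perm_inj.
  apply/idP/idP => hX; rewrite inE; apply/andP; (split; first exact/eqP);
    apply/forallP => d; apply/implyP => /andP[bd /eqP dc];
    have [di wdi] := XP _ _ hX bd dc; have /andP[bd' wdb] := SP _ _ bd.
  (* If [w j] were below [w d], then [b d i j] would be an occurrence of 4231. *)
  - have dj := ltn_trans di ij.
    rewrite dj /= ltnNge; apply/negP => wjd.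
    apply: (no4231 b d i j); rewrite ?bd' ?di ?wdi ?andbT //.
    rewrite ltn_neqAle wjd; apply/andP; split=> //; apply/eqP.
    by move=> /val_inj/perm_inj e; move: dj; rewrite e ltnn.
  have wd := ltn_trans wdi wji.
  rewrite wd andbT ltnNge; apply/negP => id.
  have idlt : (i < d)%N.
    rewrite ltn_neqAle id andbT; apply/eqP => /val_inj e.
    by move: wd; rewrite e ltnn.
  (* For [i] left of [b], the positions [i b d j] form a 3412 with [(b, d)] a cover; for [i] right
     of [b], the point [i] lies inside the rectangle of [(b, d)]. *)
  case: (ltngtP i b) => [ilt|bi|/val_inj//].
    by apply: (no3412 b d i j); rewrite ?(subsetP SC) ?wdi.
  by have := empty _ _ i bd; rewrite bi idlt wd wib => /(_ isT).
(* With the bridge removed, the labelling can be refined by membership in [X]. This gains at least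
   one label, since [b] and [c] share the old label but not the new one. *)
have := IH _ (fun i => (kap i, i \in X)) (S :\ (b, c)).
rewrite -ltnS; have := cardsD1 (b, c) S; rewrite bcS add1n => SE.
rewrite -SE => /(_ Sk) h.
have {}h := h (subset_trans (subsetDl _ _) SC).
apply: leq_trans _ (h _); last first.
  by move=> i j ijS; rewrite (Xclosed _ _ ijS); move: ijS; rewrite inE => /andP[_ /kapS ->].
rewrite SE addSn -addnS leq_add2l.
set I' := [set _ | i : 'I_n] in h *.
have cI : (kap c, true) \in I' by apply/imsetP; exists c; rewrite // cX.
rewrite (cardsD1 (kap c, true)) cI add1n ltnS.
apply: leq_trans (leq_imset_card fst _); apply/subset_leq_card/subsetP.
move=> _ /imsetP[i _ ->].
have [e|ne] := eqVneq (kap i, i \in X) (kap c, true).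
  apply/imsetP; exists (kap b, false); last by case: e => -> _; rewrite -(kapS _ _ bcS).
  rewrite in_setD1 xpair_eqE andbF; apply/imsetP; by exists b; rewrite // (negPf bX).
apply/imsetP; exists (kap i, i \in X) => //.
by rewrite in_setD1 ne; apply/imsetP; exists i.
Qed.

(** Start with all labels distinct and add the edges one at a time: each merges at most two
    labels. *)
Lemma graph_labelling (V : finType) (E : {set V * V}) :
  exists2 kap : V -> V, (forall x y, (x, y) \in E -> kap x = kap y) &
    (#|V| <= #|[set kap x | x : V]| + #|E|)%N.
Proof.
move: {2}#|E| (erefl #|E|) => k; elim: k E => [|k IH] E.
  move=> /cards0_eq ->; exists id; first by move=> x y; rewrite inE.
  by rewrite card_imset // cards0 addn0.
case: (set_0Vmem E) => [->|[[x y] xyE]]; first by rewrite cards0.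
rewrite (cardsD1 (x, y)) xyE add1n => -[Ek].
have [kap kapE le] := IH _ Ek.
exists (fun z => if kap z == kap y then kap x else kap z) => [z t ztE|].
  have [[-> ->]|ne] := eqVneq (z, t) (x, y); first by rewrite eqxx; case: eqP.
  by rewrite (kapE z t) // !inE ne.
apply: leq_trans le _; rewrite addnS -addSn leq_add2r.
rewrite (cardsD1 (kap y)) -addn1 addnC leq_add //; last by case: (_ \in _).
apply/subset_leq_card/subsetP => u /setD1P[ne /imsetP[z _ uE]]; rewrite uE in ne *.
by apply/imsetP; exists z; rewrite // (negPf ne).
Qed.

(** * Pattern occurrences as inequalities between four positions *)

Lemma no4231_of_avoids n (w : 'S_n) (a b c d : 'I_n) : avoids p4231 w ->
  (a < b < c)%N -> (c < d)%N -> (w d < w b < w c)%N -> (w c < w a)%N -> False.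
Proof.
move=> /existsPn/(_ [ffun k => tnth [tuple a; b; c; d] k])/negP no abc cd wbc wca.
apply: no; apply/forallP => -[i hi]; apply/forallP => -[j hj].
apply/implyP; rewrite !ffunE !(tnth_nth a) !(tnth_nth 0%N) /=.
by case: i hi => [|[|[|[|i]]]] // _; case: j hj => [|[|[|[|j]]]] //= _ _; lia.
Qed.

Lemma p3412_at n (w : 'S_n) (a b c d : 'I_n) :
  (a < b < c)%N -> (c < d)%N -> (w c < w d < w a)%N -> (w a < w b)%N ->
  pattern_at p3412 w [ffun k => tnth [tuple a; b; c; d] k].
Proof.
move=> abc cd wdc wab.
apply/forallP => -[i hi]; apply/forallP => -[j hj].
apply/implyP; rewrite !ffunE !(tnth_nth a) !(tnth_nth 0%N) /=.
by case: i hi => [|[|[|[|i]]]] // _; case: j hj => [|[|[|[|j]]]] //= _ _; lia.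
Qed.

Lemma gap_le n (w : 'S_n) (a b c d : 'I_n) :
  (a < b < c)%N -> (c < d)%N -> (w c < w d < w a)%N -> (w a < w b)%N ->
  (gap3412 w <= w a - w d)%N.
Proof.
move=> abc cd wdc wab; have := p3412_at abc cd wdc wab.
set f := finfun _ => pf; rewrite /gap3412.
have -> : (w a - w d = w (f ord0) - w (f ord_max))%N by rewrite !ffunE !(tnth_nth a).
have := mem_index_enum f; elim: (index_enum _) => // g s IH; rewrite big_cons inE.
case/orP=> [/eqP <-|/IH h]; first by rewrite pf geq_minl.
by case: ifP => // _; rewrite geq_min h orbT.
Qed.

(* If an occurrence of 3412 has no letter lying strictly inside it, then two
   letters with consecutive values give an occurrence of gap one. *)
Lemma no3412_of_gap n (w : 'S_n) (a b c d : 'I_n) : (1 < gap3412 w)%N ->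
  (b, c) \in covers w -> (a < b)%N -> (c < d)%N -> (w c < w d < w a)%N ->
  (w a < w b)%N -> False.
Proof.
move=> gap; rewrite inE /= => /and3P[bc _ /forallP empty] ab cd.
move=> /andP[wcd wda] wab.
have {}empty x : (w d <= w x <= w a)%N -> (x < b)%N || (c < x)%N.
  move=> wx; have := empty x; rewrite !negb_and -!leqNgt => h.
  have xb : x != b by apply/eqP => e; move: wx; rewrite e; lia.
  have xc : x != c by apply/eqP => e; move: wx; rewrite e; lia.
  by move: xb xc; rewrite -!val_eqE /= => xb xc; move: h; lia.
(* Going up from [w d], every value up to [w a] is shown to sit right of [c], which is absurd for
   [a]. A first failure at [x], next to the preceding value at [y], makes [x b c y] a 3412 of gap
   one. *)
suff step k : (w d + k <= w a)%N -> forall x, w x = (w d + k)%N :> nat -> (c < x)%N.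
  by have := step (w a - w d)%N; rewrite subnKC ?(ltnW wda) // => /(_ (leqnn _) a erefl); lia.
elim: k => [|k IH] le x wx.
  by move: wx; rewrite addn0 => /val_inj/perm_inj ->.
have yn : (w d + k < n)%N by apply: leq_trans (ltn_ord (w x)); rewrite wx addnS.
have [y wy] : exists y, w y = (w d + k)%N :> nat.
  by exists (w^-1 (Ordinal yn))%g; rewrite permKV.
have cy : (c < y)%N by apply: IH wy; lia.
have /orP[xb|//] : (x < b)%N || (c < x)%N by apply: empty; rewrite wx; lia.
have := @gap_le n w x b c y; rewrite wx wy xb bc cy.
rewrite addnS subSnn; move: gap => /[swap] /(_ isT isT); lia.
Qed.

(** * Wires of a product of parabolic elements *)

Definition parabolic n (J : 'I_n * 'I_n) (v : 'S_n) : bool :=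
  [forall k : 'I_n, ~~ in_itv J k ==> (v k == k)].

Fixpoint parabolic_product n (s : seq ('I_n * 'I_n)) (w : 'S_n) : Prop :=
  if s is J :: s' then
    exists u v, [/\ parabolic J u, parabolic_product s' v & w = (u * v)%g]
  else w = 1%g.

Lemma parabolic_fix n (J : 'I_n * 'I_n) (v : 'S_n) k :
  parabolic J v -> ~~ in_itv J k -> v k = k.
Proof. by move=> /forallP/(_ k)/implyP h /h/eqP. Qed.

Lemma parabolic_itv n (J : 'I_n * 'I_n) (v : 'S_n) k :
  parabolic J v -> in_itv J (v k) = in_itv J k.
Proof.
move=> vJ; case: (boolP (in_itv J k)) => kJ; last by rewrite (parabolic_fix vJ kJ) (negPf kJ).
apply: contraT => vkJ; have /perm_inj e := parabolic_fix vJ vkJ.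
by rewrite e kJ in vkJ.
Qed.

(** An outside point is fixed and lies on the same side of the whole interval, which is mapped to
    itself. *)
Lemma parabolic_lt n (J : 'I_n * 'I_n) (v : 'S_n) (x y : 'I_n) :
  parabolic J v -> ~~ (in_itv J x && in_itv J y) -> (x < y)%N -> (v x < v y)%N.
Proof.
move=> vJ xyJ xy; have := parabolic_itv x vJ; have := parabolic_itv y vJ.
case: (boolP (in_itv J x)) xyJ => xJ /=; case: (boolP (in_itv J y)) => yJ // _.
- rewrite (parabolic_fix vJ yJ) => _; move: xJ yJ; rewrite /in_itv; lia.
- rewrite (parabolic_fix vJ xJ) => + _; move: xJ yJ; rewrite /in_itv; lia.
by rewrite (parabolic_fix vJ xJ) (parabolic_fix vJ yJ).
Qed.

Lemma parabolic1 n (J : 'I_n * 'I_n) : parabolic J 1%g.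
Proof. by apply/forallP => k; apply/implyP; rewrite perm1. Qed.

Lemma parabolicM n (J : 'I_n * 'I_n) (v u : 'S_n) :
  parabolic J v -> parabolic J u -> parabolic J (v * u)%g.
Proof.
move=> vJ uJ; apply/forallP => k; apply/implyP => kJ.
by rewrite permM (parabolic_fix vJ kJ) (parabolic_fix uJ kJ).
Qed.

Lemma parabolic_tperm n (J : 'I_n * 'I_n) x y :
  in_itv J x -> in_itv J y -> parabolic J (tperm x y).
Proof.
move=> xJ yJ; apply/forallP => k; apply/implyP => kJ.
by rewrite tpermD //; [move: xJ|move: yJ]; apply: contraTneq => ->.
Qed.

Lemma parabolic_productP n d (s : seq ('I_n * 'I_n)) (w : 'S_n) :
  parabolic_product s w <->
  exists2 u : nat -> 'S_n,
    forall j, (j < size s)%N -> parabolic (nth d s j) (u j) &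
    w = (\prod_(0 <= j < size s) u j)%g.
Proof.
elim: s w => [|J s IH] w /=.
  by split=> [->|[u _ ->]]; [exists (fun=> 1%g) => //|]; rewrite big_nil.
split=> [[u [v [uJ /IH[us usP ->] ->]]]|[u uP ->]].
  exists (fun j => if j is j'.+1 then us j' else u); first by case.
  by rewrite big_nat_recl.
exists (u 0%N), (\prod_(0 <= j < size s) u j.+1)%g; split.
- exact: (uP 0%N).
- by apply/IH; exists (fun j => u j.+1) => // j js; apply: (uP j.+1).
by rewrite big_nat_recl.
Qed.

(* A factorization w = u_0 ... u_(m-1) is read as a family of wires: the wire of
   k is at height pos t k before the t-th factor. *)
Section Wires.
Variables (n m : nat) (A : m.-tuple ('I_n * 'I_n)) (u : nat -> 'S_n).
Hypothesis uA : forall j : 'I_m, parabolic (tnth A j) (u j).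
Implicit Types (i j s t : 'I_m) (a b c d k : 'I_n).

Definition pos (t : nat) : 'S_n := (\prod_(0 <= j < t) u j)%g.
Definition visits j k : bool := in_itv (tnth A j) (pos j k).

Lemma pos0 k : pos 0 k = k.
Proof. by rewrite /pos big_nil perm1. Qed.

Lemma posS (t : nat) k : pos t.+1 k = u t (pos t k).
Proof. by rewrite /pos big_nat_recr //= permM. Qed.

Lemma pos_itv j k : in_itv (tnth A j) (pos j.+1 k) = visits j k.
Proof. by rewrite posS parabolic_itv. Qed.

Lemma pos_stay (s t : nat) k : (s <= t <= m)%N ->
  (forall j, (s <= j < t)%N -> ~~ visits j k) -> pos t k = pos s k.
Proof.
elim: t => [|t IH] /andP[st tm] no; first by move: st; rewrite leqn0 => /eqP ->.
move: st; rewrite leq_eqVlt => /orP[/eqP -> //|st].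
rewrite -IH ?(ltnW tm) ?andbT //; last by move=> j /andP[sj jt]; apply: no; rewrite sj ltnW.
rewrite posS (parabolic_fix (uA (Ordinal tm))) //.
by apply: (no (Ordinal tm)); rewrite /= ltnSn andbT.
Qed.

(** A factor can reverse the order of two wires only if both heights lie in its interval. *)
Lemma inversion_meet a b : (a < b)%N -> (pos m b < pos m a)%N ->
  exists j, visits j a && visits j b.
Proof.
move=> ab; case: (pickP (fun j => visits j a && visits j b)) => [j|no]; first by exists j.
suff h (t : nat) : (t <= m)%N -> (pos t a < pos t b)%N by rewrite ltnNge (ltnW (h m (leqnn m))).
elim: t => [|t IH] tm; first by rewrite !pos0.
rewrite !posS; apply: (parabolic_lt (uA (Ordinal tm))); last exact/IH/ltnW.
by have := no (Ordinal tm); rewrite /visits /= => ->.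
Qed.

(** The transposition of the two heights can be absorbed into the factor [u j]; moved to the front
    through the earlier factors, it becomes [tperm a b]. *)
Lemma swap_wires j a b : visits j a -> visits j b ->
  parabolic_product A (tperm a b * pos m)%g.
Proof.
move=> ja jb; apply/(parabolic_productP (tnth A j)); rewrite size_tuple.
exists (fun i : nat => if i == j :> nat then (tperm (pos j a) (pos j b) * u j)%g else u i).
  move=> i im /=; have -> : nth (tnth A j) A i = tnth A (Ordinal im).
    by rewrite [RHS](tnth_nth (tnth A j)).
  case: eqP => [e|_]; last exact: (uA (Ordinal im)).
  have -> : Ordinal im = j by apply: val_inj.
  by apply: parabolicM => //; apply: parabolic_tperm.
have jm := ltn_ord j.
have split (F : nat -> 'S_n) : (\prod_(0 <= i < m) F i =
    \prod_(0 <= i < j) F i * F j * \prod_(j.+1 <= i < m) F i)%g.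
  by rewrite (big_cat_nat (n := j)) ?(ltnW jm) //= [X in (_ * X)%g]big_ltn // mulgA.
rewrite /pos !split eqxx -/(pos j) !mulgA.
congr (_ * _)%g; last by apply: eq_big_nat => i /andP[ji _]; rewrite gtn_eqF.
rewrite (@eq_big_nat _ _ _ 0 j _ u) => [|i /andP[_ ij]]; last by rewrite ltn_eqF.
by rewrite -/(pos j) -tpermJ conjgE !mulgA mulgV mul1g.
Qed.

Definition overlap_edges : {set 'I_m * 'I_m} :=
  [set p : 'I_m * 'I_m | (p.1 < p.2)%N && (overlap A p.1 p.2 != set0)].

(** Between the two visits the wire keeps its height, and this height witnesses the overlap. *)
Lemma consecutive_visits i j k : (i < j)%N -> visits i k -> visits j k ->
  (forall t, (i < t < j)%N -> ~~ visits t k) -> (i, j) \in overlap_edges.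
Proof.
move=> ij vi vj no; rewrite inE ij /=; apply/set0Pn; exists (pos j k).
have stay (t : nat) : (i < t <= j)%N -> pos t k = pos i.+1 k.
  case/andP=> it tj; apply: pos_stay; first by rewrite it (leq_trans tj) // ltnW.
  by move=> s /andP[si st]; apply: no; rewrite si (leq_trans st).
rewrite !inE; apply/andP; split; last first.
  by rewrite {1}(stay j) ?ij ?leqnn // pos_itv vi.
apply/bigcupP => -[t /andP[it tj]]; rewrite inE => h.
have := no t; rewrite it tj => /(_ isT)/negP; apply.
by rewrite /visits (stay t) ?it ?(ltnW tj) // -(stay j) ?ij ?leqnn.
Qed.

(** Induction on [j], stepping back to the previous visit. The hypothesis concerns only edges
    between visits of this wire from [i] on, so that an edge not travelled may be excluded. *)
Lemma walk_constant (K : eqType) (kap : 'I_m -> K) k i j :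
    (i <= j)%N -> visits i k -> visits j k ->
    (forall s t, (i <= s)%N -> visits s k -> visits t k ->
       (s, t) \in overlap_edges -> kap s = kap t) ->
  kap i = kap j.
Proof.
move=> + vi + kapE; have [N jN] := ubnP j; elim: N j jN => // N IH j jN.
rewrite leq_eqVlt => /orP[/eqP/val_inj -> //|ij] vj.
case: (@arg_maxnP _ i [pred s : 'I_m | (i <= s < j)%N && visits s k] val).
  by rewrite inE leqnn ij vi.
move=> s /andP[/andP[si sj] vs] smax.
rewrite (IH s) //; last by apply: leq_trans sj _; rewrite -ltnS.
apply: kapE => //; apply: (consecutive_visits sj vs vj) => t /andP[st tj].
apply/negP => vt.
have : (t <= s)%N by apply: smax; rewrite inE tj vt (leq_trans si (ltnW st)).
by rewrite leqNgt st.
Qed.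

Section Walk.
Variables (K : eqType) (kap : 'I_m -> K) (x y : 'I_m).
Hypothesis kapE : forall i j,
  (i, j) \in overlap_edges -> (i, j) != (x, y) -> kap i = kap j.

(** A wire can use the excluded edge only if it visits both [x] and [y], and a walk starting at [y]
    or later has already passed [x]. *)
Lemma walk_le k i j : (i <= j)%N -> visits i k -> visits j k ->
  [|| ~~ visits x k, ~~ visits y k | (y <= i)%N] -> (x < y)%N -> kap i = kap j.
Proof.
move=> ij vi vj avoid xy; apply: walk_constant ij vi vj _ => s t si vs vt st.
apply: kapE => //; apply: contraTneq avoid => -[sx ty].
have : (s < t)%N by move: st; rewrite inE => /andP[].
by rewrite -sx -ty vs vt -ltnNge; apply: leq_ltn_trans.
Qed.

Lemma walk_avoid k i j : (x < y)%N -> visits i k -> visits j k ->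
  ~~ visits x k || ~~ visits y k -> kap i = kap j.
Proof.
move=> xy vi vj avoid; have [ij|ji] := leqP i j.
  by apply: (walk_le ij vi vj) => //; case/orP: avoid => ->; rewrite ?orbT.
apply/esym/(walk_le (ltnW ji) vj vi) => //.
by case/orP: avoid => ->; rewrite ?orbT.
Qed.

End Walk.

(* The nodes i, j and two common nodes of the wires of b, c and of b, d close up
   to a cycle; the edge by which the wire of a finally leaves that of c is used
   by no other part of it. *)
Lemma not_bridge a b c d i j : (i < j)%N ->
    visits i a -> visits i c -> visits j a -> visits j d ->
    (exists t, visits t b && visits t c) -> (exists t, visits t b && visits t d) ->
    (forall t, ~~ (visits t a && visits t b)) ->
    (forall t, ~~ (visits t c && visits t d)) ->
  exists x y, (x, y) \in overlap_edges /\
    forall (K : eqType) (kap : 'I_m -> K),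
      (forall s t, (s, t) \in overlap_edges -> (s, t) != (x, y) -> kap s = kap t) ->
      kap x = kap y.
Proof.
move=> ij ia ic ja jd [r /andP[rb rc]] [s /andP[sb sd]] ab cd.
(* The edge is chosen so that [x] is the last common node of [a] and [c] before [j], and [y] is the
   next node on the wire of [a]. *)
case: (@arg_maxnP _ i [pred t : 'I_m | [&& (t < j)%N, visits t a & visits t c]] val).
  by rewrite inE ij ia ic.
move=> x /and3P[xj xa xc] xmax.
case: (@arg_minnP _ j [pred t : 'I_m | (x < t)%N && visits t a] val).
  by rewrite inE xj ja.
move=> y /andP[xy ya] ymin; exists x, y; split.
  apply: (consecutive_visits xy xa ya) => t /andP[xt ty]; apply/negP => ta.
  have : (y <= t)%N by apply: ymin; rewrite inE xt ta.
  by rewrite leqNgt ty.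
have yj : (y <= j)%N by apply: ymin; rewrite inE xj ja.
(* Otherwise [c] meets [d] at [y = j], or [y] is a later common node of [a] and [c]. *)
have yc : ~~ visits y c.
  apply/negP => yc; move: yj; rewrite leq_eqVlt => /orP[/eqP/val_inj e|yj].
    by have /negP[] := cd j; rewrite jd -{1}e yc.
  have : (y <= x)%N by apply: xmax; rewrite inE yj ya yc.
  by rewrite leqNgt xy.
have xb : ~~ visits x b by have := ab x; rewrite xa.
have xd : ~~ visits x d by have := cd x; rewrite xc.
move=> K kap kapE.
(* The detour from [x] to [y] follows [c] to [r], [b] to [s], [d] to [j], and [a] back to [y]. *)
rewrite (walk_avoid kapE xy xc rc) ?yc ?orbT //.
rewrite (walk_avoid kapE xy rb sb) ?xb //.
rewrite (walk_avoid kapE xy sd jd) ?xd //.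
by apply/esym/(walk_le kapE yj ya ja); rewrite ?leqnn ?orbT.
Qed.

(** Deleting an edge of the cycle before labelling saves one label, and the rest of the cycle keeps
    the labelling constant on that edge. *)
Lemma overlap_cycle a b c d :
    (exists t, visits t a && visits t c) -> (exists t, visits t a && visits t d) ->
    (exists t, visits t b && visits t c) -> (exists t, visits t b && visits t d) ->
    (forall t, ~~ (visits t a && visits t b)) ->
    (forall t, ~~ (visits t c && visits t d)) ->
  exists kap : 'I_m -> 'I_m,
    (forall i j, (i, j) \in overlap_edges -> kap i = kap j) /\
    (m < #|[set kap i | i : 'I_m]| + #|overlap_edges|)%N.
Proof.
move=> [i /andP[ia ic]] [j /andP[ja jd]] bc bd ab cd.
suff [x [y [xy nb]]] : exists x y, (x, y) \in overlap_edges /\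
    forall (K : eqType) (kap : 'I_m -> K),
      (forall s t, (s, t) \in overlap_edges -> (s, t) != (x, y) -> kap s = kap t) ->
      kap x = kap y.
  have [kap kapE] := graph_labelling (overlap_edges :\ (x, y)).
  have kapE' s t : (s, t) \in overlap_edges -> (s, t) != (x, y) -> kap s = kap t.
    by move=> st ne; apply: kapE; rewrite in_setD1 ne.
  rewrite card_ord => le; exists kap; split=> [s t st|].
    have [[-> ->]|ne] := eqVneq (s, t) (x, y); last exact: kapE'.
    exact: nb.
  by rewrite (cardsD1 (x, y) overlap_edges) xy add1n addnS ltnS.
(* The case [j < i] exchanges [c] and [d]; for [i = j] the wires of [c] and [d] would meet. *)
case: (ltngtP i j) => [ij|ji|/val_inj e].
- exact: (not_bridge ij ia ic ja jd bc bd ab cd).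
- by apply: (not_bridge ji ja jd ia ic bd bc ab) => t; rewrite andbC.
by have /negP[] := cd j; rewrite jd -{1}e ic.
Qed.

(** A position takes the label of any node on its wire, and a label of its own if there is none.
    Inverted positions share a node, and since the intervals are nonempty every node lies on some
    wire. *)
Lemma labelling_of_cycle :
    (forall j, (tnth A j).1 <= (tnth A j).2)%N ->
    forall kap : 'I_m -> 'I_m,
    (forall i j, (i, j) \in overlap_edges -> kap i = kap j) ->
  exists lab : 'I_n -> 'I_m + 'I_n,
    (forall a b, (a < b)%N -> (pos m b < pos m a)%N -> lab a = lab b) /\
    (#|[set kap i | i : 'I_m]| + #|[set k | [forall j, ~~ in_itv (tnth A j) k]]|
       <= #|[set lab k | k : 'I_n]|)%N.
Proof.
move=> ne kap kapE.
pose lab k : 'I_m + 'I_n := if [pick j | visits j k] is Some j then inl (kap j) else inr k.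
have labE j k : visits j k -> lab k = inl (kap j).
  rewrite /lab; case: pickP => [i vi vj|/(_ j) -> //]; congr inl.
  have [ij|ji] := leqP i j; first by apply: (walk_constant ij vi vj) => *; apply: kapE.
  by apply/esym/(walk_constant (ltnW ji) vj vi) => *; apply: kapE.
exists lab; split=> [a b ab /(inversion_meet ab)[j /andP[ja jb]]|].
  by rewrite (labE _ _ ja) (labE _ _ jb).
rewrite -(card_imset [set kap i | i : 'I_m] (@inl_inj _ 'I_n)).
rewrite -(card_imset [set k | _] (@inr_inj 'I_m _)) -cardsUI.
rewrite [X in (_ + X)%N](_ : _ = 0%N) ?addn0; last first.
  apply/eqP; rewrite cards_eq0 -subset0; apply/subsetP => z.
  by rewrite inE => /andP[/imsetP[i _ ->] /imsetP[]].
apply/subset_leq_card/subsetP => z; rewrite inE => /orP[] /imsetP[y + ->{z}].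
  case/imsetP=> j _ ->; apply/imsetP.
  exists ((pos j)^-1 (tnth A j).1)%g => //; rewrite (labE j) //.
  by rewrite /visits permKV /Defs.in_itv leqnn ne.
rewrite inE => /forallP out; apply/imsetP; exists y => //.
rewrite /lab; case: pickP => // j; rewrite /visits.
suff -> : pos j y = y by rewrite (negPf (out j)).
suff h (t : nat) : (t <= m)%N -> pos t y = y by apply/h/ltnW.
elim: t => [|t IH] tm; first by rewrite pos0.
by rewrite posS IH ?(ltnW tm) // (parabolic_fix (uA (Ordinal tm))).
Qed.

End Wires.

(** Counted position by position: [k] lies in [overlap A i j] exactly when [i] and [j] are
    consecutive among the intervals containing [k], which gives one pair fewer than such intervals.
    An uncovered [k] is compensated by the last summand. *)
Lemma overlap_count n m (A : m.-tuple ('I_n * 'I_n)) :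
  (n + \sum_(i < m) \sum_(j < m | i < j) #|overlap A i j| <=
   \sum_(i < m) #|itv_set (tnth A i)| + #|[set k | [forall j, ~~ in_itv (tnth A j) k]]|)%N.
Proof.
have cardE (T : finType) (S : {set T}) : #|S| = (\sum_x (x \in S))%N.
  by rewrite -sum1_card big_mkcond.
pose P k := [set p : 'I_m * 'I_m | (p.1 < p.2)%N && (k \in overlap A p.1 p.2)].
pose D k := [set j | in_itv (tnth A j) k].
have -> : (\sum_(i < m) \sum_(j < m | i < j) #|overlap A i j| = \sum_k #|P k|)%N.
  rewrite pair_big_dep /=; under eq_bigr => p _ do rewrite cardE.
  rewrite exchange_big /=; apply: eq_bigr => k _; rewrite cardE [LHS]big_mkcond.
  by apply: eq_bigr => -[i j] _; rewrite [in RHS]inE /=; case: (i < j)%N.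
have -> : (\sum_(i < m) #|itv_set (tnth A i)| = \sum_k #|D k|)%N.
  under eq_bigr => i _ do rewrite cardE.
  rewrite exchange_big /=; apply: eq_bigr => k _; rewrite cardE.
  by apply: eq_bigr => i _; rewrite !inE.
rewrite [X in (X + _ <= _)%N](_ : _ = (\sum_(k < n) 1)%N); last first.
  by rewrite sum_nat_const card_ord muln1.
rewrite cardE -!big_split /=; apply: leq_sum => k _; rewrite inE.
have PD i j : (i, j) \in P k -> [/\ (i < j)%N, i \in D k, j \in D k &
    forall t : 'I_m, (i < t < j)%N -> t \notin D k].
  rewrite inE /= => /andP[ij]; rewrite !inE => /andP[out /andP[ki kj]].
  split; rewrite ?inE // => t itj; apply: contra out; rewrite inE => kt.
  by apply/bigcupP; exists t; rewrite // inE.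
case: (set_0Vmem (D k)) => [D0|[j0 j0D]].
  have -> : [forall j, ~~ in_itv (tnth A j) k].
    by apply/forallP => j; apply/negP => kj; have := in_set0 j; rewrite -D0 inE kj.
  rewrite D0 cards0 addnC leq_add2r leqn0 cards_eq0 -subset0.
  by apply/subsetP => -[i j] /PD[_]; rewrite D0 inE.
case: (@arg_minnP _ j0 (mem (D k)) val j0D) => j1 j1D j1min.
have {}j1D : j1 \in D k by [].
apply: leq_trans (leq_addr _ _); rewrite (cardsD1 j1 (D k)) j1D leq_add2l.
rewrite -(card_in_imset (f := snd) (D := P k)); last first.
  move=> [i j] [i' j'] /PD[ij iD jD no] /PD[ij' iD' jD' no'] /= e.
  rewrite -e in ij' no' *; congr (_, _); apply/val_inj/eqP.
  case: (ltngtP i i') => // lt.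
    by have := no i'; rewrite lt ij' => /(_ isT); rewrite iD'.
  by have := no' i; rewrite lt ij => /(_ isT); rewrite iD.
apply/subset_leq_card/subsetP => _ /imsetP[[i j] /PD[ij iD jD _] ->] /=.
rewrite in_setD1 jD andbT; apply: contraTneq ij => ->.
by rewrite -leqNgt; apply: j1min.
Qed.

(** The combinatorial half of the argument: the forest bound on [covers w], the extra label from the
    cycle and [overlap_count] combine into the inequality opposite to the one given by linear
    coefficients. *)
Lemma covers_lt_of_3412 n m (A : m.-tuple ('I_n * 'I_n)) (w : 'S_n) :
    (forall j, (tnth A j).1 <= (tnth A j).2)%N ->
    parabolic_product A w ->
    (forall v, parabolic_product A v -> (len v <= len w)%N) ->
    avoids p4231 w -> ~~ avoids p3412 w -> (1 < gap3412 w)%N ->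
  (#|covers w| + \sum_(i < m) \sum_(j < m | i < j) #|overlap A i j|.-1 <
   \sum_(i < m) #|itv_set (tnth A i)|.-1)%N.
Proof.
move=> ne Aw Amax h4231 h3412 hgap.
have [f wf] : exists f, pattern_at p3412 w f by apply/existsP; move: h3412; rewrite negbK.
have [d0 _] : exists d : 'I_n * 'I_n, true by exists (f ord0, f ord0).
have /(parabolic_productP d0)[u uA wE] := Aw; rewrite size_tuple in uA wE.
have {}uA (j : 'I_m) : parabolic (tnth A j) (u j) by rewrite (tnth_nth d0) uA.
have {}wE : w = pos u m by [].
have fP (i j : 'I_4) : (i < j)%N ->
    (f i < f j)%N /\ (w (f i) < w (f j))%N = (tnth p3412 i < tnth p3412 j)%N.
  by move=> ij; move: wf => /forallP/(_ i)/forallP/(_ j); rewrite ij => /andP[? /eqP].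
have meet (i j : 'I_4) : (i < j)%N -> ~~ (tnth p3412 i < tnth p3412 j)%N ->
    exists t, visits A u t (f i) && visits A u t (f j).
  move=> ij; have [fij <-] := fP _ _ ij; rewrite -leqNgt => wij.
  apply: (inversion_meet uA fij); rewrite -wE ltn_neqAle wij andbT.
  by rewrite (inj_eq val_inj) (inj_eq perm_inj) -val_eqE gtn_eqF.
(* If two letters that are not inverted met, swapping their wires would give a longer product. *)
have apart (i j : 'I_4) : (i < j)%N -> (tnth p3412 i < tnth p3412 j)%N ->
    forall t, ~~ (visits A u t (f i) && visits A u t (f j)).
  move=> ij; have [fij <-] := fP _ _ ij; move=> wij t.
  apply/negP => /andP[ti tj]; have := Amax _ (swap_wires uA ti tj).
  by rewrite -wE leqNgt len_tperm_asc.
pose o (k : nat) : 'I_4 := inord k.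
have oE (k : nat) : (k < 4)%N -> o k = k :> nat by move=> k4; rewrite inordK.
have [kap [kapE cyc]] : exists kap : 'I_m -> 'I_m,
    (forall i j, (i, j) \in overlap_edges A -> kap i = kap j) /\
    (m < #|[set kap i | i : 'I_m]| + #|overlap_edges A|)%N.
  by apply: (@overlap_cycle n m A u uA (f (o 0)) (f (o 1)) (f (o 2)) (f (o 3)));
    first [apply: meet|apply: apart]; rewrite ?(tnth_nth 0%N) ?oE.
have [lab [labE labn]] := labelling_of_cycle uA ne kapE.
have forest : (#|covers w| + #|[set lab k | k : 'I_n]| <= n)%N.
  apply: (forest_covers (w := w)) => [a b c d|b c l x bc lb cx /andP[wcx wxl] wlb||i j].
  - exact: no4231_of_avoids.
  - by apply: (no3412_of_gap hgap bc lb cx); rewrite ?wcx.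
  - exact: subxx.
  by rewrite inE /= wE => /and3P[ij wji _]; apply: labE.
have split1 : (\sum_(i < m) #|itv_set (tnth A i)| =
    \sum_(i < m) #|itv_set (tnth A i)|.-1 + m)%N.
  rewrite -[X in (_ + X)%N](card_ord m) -sum1_card -big_split /=.
  apply: eq_bigr => i _; rewrite addn1 prednK // card_gt0.
  by apply/set0Pn; exists (tnth A i).1; rewrite inE /Defs.in_itv leqnn ne.
(* An empty overlap has truncated predecessor 0, so only the edges of the graph lose one. *)
have split2 : (\sum_(i < m) \sum_(j < m | i < j) #|overlap A i j| =
    \sum_(i < m) \sum_(j < m | i < j) #|overlap A i j|.-1 + #|overlap_edges A|)%N.
  rewrite -sum1_card !pair_big_dep /= [X in (_ + X)%N](eq_bigl (fun p : 'I_m * 'I_m =>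
    (p.1 < p.2)%N && (overlap A p.1 p.2 != set0))); last by move=> p; rewrite inE.
  rewrite [X in (_ + X)%N]big_mkcondr -big_split /=; apply: eq_bigr => p _.
  by rewrite -card_gt0; case: #|_| => //= k; rewrite addn1.
have := overlap_count A; rewrite split1 split2; lia.
Qed.

(** * Reversals in the Bruhat order *)

Lemma reversal_parabolic n (J : 'I_n * 'I_n) : parabolic J (reversal J).
Proof.
apply/forallP => k; apply/implyP => kJ.
by rewrite permE /rev_fun (negPf kJ).
Qed.

(** A step down transposes an inverted pair, and by [parabolic_lt] both of its positions lie in
    [J]. *)
Lemma parabolic_bruhat n (J : 'I_n * 'I_n) (v w : 'S_n) :
  parabolic J w -> bruhat v w -> parabolic J v.
Proof.
move=> wJ /connectP[p]; elim: p v => [|u p IH] v /=; first by move=> _ <-.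
move=> /andP[vu up] wE; have uJ := IH _ up wE.
have [a [b [ab uba ->]]] := bruhat_stepP vu.
have : in_itv J a && in_itv J b.
  apply: contraT => abJ; have := parabolic_lt uJ abJ ab.
  by rewrite ltnNge (ltnW uba).
by case/andP=> aJ bJ; apply: parabolicM => //; apply: parabolic_tperm.
Qed.

Lemma parabolic_sgen n (J : 'I_n * 'I_n) (v : 'S_n) i : ~~ asc i v ->
  parabolic J v -> in_itv J (lo i) && in_itv J (hi i).
Proof.
move=> av vJ; apply: contraT => iJ; case/negP: av.
by apply: (parabolic_lt vJ iJ) => /=.
Qed.

(** Climb from [v] by ascents inside [J]; the induction terminates because lengths are at most
    [n * n]. When no such ascent is left, [reversal J * v] has only ascents and is the identity. *)
Lemma bruhat_reversal n (J : 'I_n * 'I_n) (v : 'S_n) :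
  parabolic J v -> bruhat v (reversal J).
Proof.
have [N] := ubnP (n * n - len v); elim: N v => // N IH v vN vJ.
case: (pickP (fun i => [&& asc i v, in_itv J (lo i) & in_itv J (hi i)])) => [i|no].
  case/and3P=> av li hi; have svJ : parabolic J (sgen i * v)%g.
    by apply: parabolicM => //; apply: parabolic_tperm.
  have lv : len (sgen i * v)%g = (len v).+1 by rewrite !lenE card_inversions_asc.
  have max : (len (sgen i * v)%g <= n * n)%N.
    by rewrite lenE (leq_trans (max_card _)) // card_prod card_ord.
  apply: (connect_trans (y := (sgen i * v)%g)).
    by have := bruhat_lt_sgen i v; rewrite av => /andP[].
  by apply: IH => //; move: vN max; rewrite lv; lia.
suff e : (reversal J * v = 1)%g.
  have -> : v = reversal J; last exact: connect0.
  have rr : (reversal J * reversal J = 1)%g.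
    by apply/permP => k; rewrite perm1 permM !permE rev_funK.
  by apply: (mulgI (reversal J)); rewrite e rr.
apply: all_asc => i; case: (boolP (in_itv J (lo i) && in_itv J (hi i))) => iJ; last first.
  by apply: (parabolic_lt _ iJ) => //=; apply: parabolicM (reversal_parabolic J) vJ.
have /andP[li hi] := iJ.
have revE k : in_itv J k -> rev_fun J k = (J.1 + J.2 - k)%N :> nat.
  move=> kJ; rewrite /rev_fun kJ val_insubd; case: ifP => // /negP[].
  by move: kJ; rewrite /Defs.in_itv => /andP[]; have := ltn_ord J.2; lia.
(* The reversal carries the adjacent pair at [i] to the one at the mirror index [i'], in the
   opposite order, so a descent of [v] at [i'] is an ascent of the product at [i]. *)
have lt : (J.1 + J.2 - Defs.hi i < n.-1)%N.
  move: (li) (hi); rewrite /Defs.in_itv /=; have := ltn_ord J.2; have := ltn_ord i; lia.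
pose i' := Ordinal lt.
have e1 : rev_fun J (lo i) = Defs.hi i'.
  apply: val_inj; rewrite /= revE //=; move: li hi; rewrite /Defs.in_itv /=; lia.
have e2 : rev_fun J (Defs.hi i) = lo i' by apply: val_inj; rewrite /= revE.
have := no i'; rewrite -e1 -e2.
have inv k : in_itv J (rev_fun J k) = in_itv J k.
  by have := parabolic_itv k (reversal_parabolic J); rewrite permE.
rewrite !inv li hi !andbT /asc !permM !permE -e1 -e2 => /negbT.
rewrite -leqNgt ltn_neqAle => ->; rewrite andbT (inj_eq val_inj) (inj_eq perm_inj).
by rewrite (inj_eq (can_inj (rev_funK J))) lo_neq_hi.
Qed.

Lemma sgen_inj n : injective (@sgen n).
Proof.
move=> i j e; have := sgenL i; rewrite e.
case: (tpermP (lo j) (hi j) (lo i)) => [h _|h|_ _].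
- by apply/val_inj; have := congr1 val h.
- by have := congr1 val h => /= hi /(congr1 val) /= lo; lia.
- by move=> h; have := lo_neq_hi i; rewrite -h eqxx.
Qed.

(** Every simple transposition inside [J] is a left descent of the reversal, and distinct ones give
    distinct coatoms. *)
Lemma coatoms_reversal n (J : 'I_n * 'I_n) : (J.1 <= J.2)%N ->
  (#|itv_set J|.-1 <= #|coatoms (reversal J)|)%N.
Proof.
move=> J12; have rJ := reversal_parabolic J.
pose S := [set i : 'I_n.-1 | (J.1 <= i < J.2)%N].
have -> : #|itv_set J|.-1 = #|itv_set J :\ J.2|.
  by rewrite (cardsD1 J.2) inE /Defs.in_itv J12 leqnn.
apply: (leq_trans (n := #|S|)).
  apply: leq_trans (leq_imset_card (@lo n) _); apply/subset_leq_card/subsetP => k.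
  rewrite !inE -val_eqE /Defs.in_itv /= => /and3P[k2 k1 kle].
  have kn : (k < n.-1)%N by have := ltn_ord J.2; lia.
  by apply/imsetP; exists (Ordinal kn); [rewrite inE /=; lia|apply: val_inj].
rewrite -(card_imset S (f := fun i => (sgen i * reversal J)%g)); last first.
  by move=> i j /mulIg /sgen_inj.
apply/subset_leq_card/subsetP => _ /imsetP[i + ->]; rewrite !inE => iS.
have [li hi] : in_itv J (lo i) /\ in_itv J (hi i) by rewrite /Defs.in_itv /=; lia.
have da : ~~ asc i (reversal J).
  have lE k : in_itv J k -> reversal J k = (J.1 + J.2 - k)%N :> nat.
    move=> kJ; rewrite permE /rev_fun kJ val_insubd; case: ifP => // /negP[].
    by move: kJ; rewrite /Defs.in_itv => /andP[]; have := ltn_ord J.2; lia.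
  by rewrite /asc !lE //=; lia.
have := bruhat_lt_sgen i (sgen i * reversal J); rewrite sgenKl asc_sgen da => -> /=.
by rewrite !lenE (card_inversions_desc da).
Qed.

(** * Supports and the index representation *)

Lemma hcoefZ (R : comNzRingType) (r : R) n v a (h : hecke r n) :
  hcoef v (a *: h) = a * hcoef v h.
Proof. exact: (linearZ_LR (hcoef v)). Qed.

Section HeckeSupport.
Variables (R : comNzRingType) (q : R) (n : nat).
Local Notation H := (hecke q n).
Implicit Types (x y z : H) (u v w : 'S_n) (i : 'I_n.-1).

Lemma hcoef_sum_scale v (F : 'S_n -> H) z :
  hcoef v (\sum_w hcoef w z *: F w) = \sum_w hcoef w z * hcoef v (F w).
Proof.
by rewrite (raddf_sum (hcoef v)) /=; apply: eq_bigr => w _; rewrite hcoefZ.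
Qed.

Lemma sum_pick (F : 'S_n -> R) v : \sum_w F w * (v == w)%:R = F v.
Proof.
rewrite (bigD1 v) //= eqxx mulr1 big1 ?addr0 // => w wv.
by rewrite eq_sym (negPf wv) mulr0.
Qed.

Lemma hcoef_lmul i v z : hcoef v (lmul_gen i z) =
  if asc i v then q * hcoef (sgen i * v)%g z
  else hcoef (sgen i * v)%g z + (q - 1) * hcoef v z.
Proof.
have eqs w : (v == sgen i * w)%g = (sgen i * v == w)%g.
  by apply/eqP/eqP => [->|<-]; rewrite sgenKl.
rewrite /lmul_gen hcoef_sum_scale.
(* The coefficients with which the term [w] contributes to [T (sgen i * w)] and to [T w],
   respectively. *)
pose F w : R := hcoef w z * (if asc i w then 1 else q).
pose G w : R := hcoef w z * (if asc i w then 0 else q - 1).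
rewrite (eq_bigr (fun w => F w * (sgen i * v == w)%g%:R + G w * (v == w)%:R)).
  rewrite big_split /= !sum_pick /F /G asc_sgen; case: asc => /=.
    by rewrite mulr0 addr0 mulrC.
  by rewrite mulr1 [_ * (q - 1)]mulrC.
move=> w _; rewrite sgenTE /F /G -eqs; case: asc.
  by rewrite hcoef_T mulr1 mulr0 mul0r addr0.
rewrite (linearD (hcoef v)) /= !hcoefZ !hcoef_T.
by rewrite mulrDr !mulrA addrC.
Qed.

Lemma T_descent i u : ~~ asc i u -> T u = T (sgen i) * T (sgen i * u)%g :> H.
Proof. by move=> du; rewrite Tsgen_mul lmul_genT sgenTE asc_sgen du sgenKl. Qed.

Lemma descent_ind (P : 'S_n -> Prop) : P 1%g ->
  (forall i u, ~~ asc i u -> P (sgen i * u)%g -> P u) -> forall u, P u.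
Proof.
move=> P1 PS u; have [N] := ubnP (len u); elim: N u => // N IH u uN.
case: (pickP (fun i => ~~ asc i u)) => [i du|no].
  apply: (PS i) => //; apply: IH; move: uN.
  by rewrite !lenE (card_inversions_desc du).
by rewrite (all_asc (w := u)) // => i; have /negbFE := no i.
Qed.

Lemma hcoef_mul v x y : hcoef v (x * y) = \sum_u hcoef u x * hcoef v (T u * y : H).
Proof.
rewrite -hcoef_sum_scale; congr (hcoef v _).
rewrite [in LHS](heckeE x) mulr_suml; apply: eq_bigr => u _.
by rewrite scalerAl.
Qed.

(** [T u] acts as a succession of generators from [J], each of which carries a coefficient at [v]
    only to [v] and [sgen i * v]. *)
Lemma mulT_support J (P : 'S_n -> Prop) u y :
    (forall i v, in_itv J (lo i) -> in_itv J (hi i) -> P v -> P (sgen i * v)%g) ->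
    (forall v, hcoef v y != 0 -> P v) -> parabolic J u ->
  forall v, hcoef v (T u * y : H) != 0 -> P v.
Proof.
move=> PJ yP; elim/descent_ind: u => [_ v|i u du IH uJ v]; first by rewrite T1 mul1r; apply: yP.
have /andP[li hi] := parabolic_sgen du uJ.
have suJ : parabolic J (sgen i * u)%g by apply: parabolicM => //; apply: parabolic_tperm.
rewrite (T_descent du) -mulrA Tsgen_mul hcoef_lmul => vn0.
have [s0|sn0] := eqVneq (hcoef (sgen i * v)%g (T (sgen i * u)%g * y : H)) 0.
  move: vn0; rewrite s0; case: asc; rewrite ?mulr0 ?eqxx // add0r => vn0.
  by apply: (IH suJ); apply: contraNneq vn0 => ->; rewrite mulr0.
by rewrite -(sgenKl i v); apply: PJ => //; apply: IH.
Qed.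

Lemma prod_support (s : seq ('I_n * 'I_n)) (F : 'I_n * 'I_n -> H) :
  (forall J v, J \in s -> hcoef v (F J) != 0 -> parabolic J v) ->
  forall v, hcoef v (\prod_(J <- s) F J) != 0 -> parabolic_product s v.
Proof.
elim: s => [|J s IH] sF v /=.
  by rewrite big_nil -T1 hcoef_T; case: (v =P 1%g) => //; rewrite mulr0n eqxx.
rewrite big_cons hcoef_mul => vn0.
have [u un0] : exists u, hcoef u (F J) * hcoef v (T u * \prod_(K <- s) F K : H) != 0.
  apply/existsP; apply: contraNT vn0 => /existsPn no; apply/eqP/big1 => u _.
  by apply/eqP; have := no u; rewrite negbK.
have uJ : parabolic J u.
  by apply: sF; rewrite ?mem_head //; apply: contraNneq un0 => ->; rewrite mul0r.
apply: (@mulT_support J (parabolic_product (J :: s)) u (\prod_(K <- s) F K)) => //.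
- move=> i w li hi [a [b [aJ bs ->]]]; exists (sgen i * a)%g, b; rewrite mulgA; split=> //.
  by apply: parabolicM => //; apply: parabolic_tperm.
- move=> w wn0; exists 1%g, w; rewrite mul1g; split=> //; first exact: parabolic1.
  by apply: IH => // K w' Ks; apply: sF; rewrite inE Ks orbT.
by apply: contraNneq un0 => ->; rewrite mulr0.
Qed.

(** The one-dimensional character sending every [T (sgen i)] to [q]. *)
Definition index_char z : R := \sum_w hcoef w z * q ^+ len w.

Lemma index_char_sum (F : 'S_n -> H) z :
  index_char (\sum_w hcoef w z *: F w) = \sum_w hcoef w z * index_char (F w).
Proof.
rewrite /index_char; under eq_bigr => w _ do rewrite hcoef_sum_scale mulr_suml.
rewrite exchange_big /=; apply: eq_bigr => w _.
by rewrite mulr_sumr; apply: eq_bigr => v _; rewrite mulrA.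
Qed.

Lemma index_char_linear : linear_for *%R index_char.
Proof.
move=> a x y; rewrite /index_char mulr_sumr -big_split /=; apply: eq_bigr => w _.
by rewrite (linearP (hcoef w)) /= mulrDl mulrA.
Qed.
HB.instance Definition _ :=
  GRing.isLinear.Build R H R *%R index_char index_char_linear.

Lemma index_charT w : index_char (T w) = q ^+ len w.
Proof.
rewrite -[RHS](sum_pick (fun v => q ^+ len v)); apply: eq_bigr => v _.
by rewrite hcoef_T mulrC eq_sym.
Qed.

Lemma index_char_lmul i z : index_char (lmul_gen i z) = q * index_char z.
Proof.
rewrite [LHS]index_char_sum mulr_sumr; apply: eq_bigr => w _.
rewrite mulrCA; congr (_ * _); rewrite sgenTE; case: (boolP (asc i w)) => a.
  by rewrite index_charT !lenE card_inversions_asc // exprS.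
rewrite linearD !linearZ /= !index_charT.
have -> : len w = (len (sgen i * w)%g).+1 by rewrite !lenE (card_inversions_desc a).
by rewrite exprS mulrBl mul1r addrNK.
Qed.

Lemma index_charM x y : index_char (x * y) = index_char x * index_char y.
Proof.
have hT u : index_char (T u * y : H) = q ^+ len u * index_char y.
  elim/descent_ind: u => [|i u du IH]; first by rewrite T1 mul1r len1 expr0 mul1r.
  rewrite (T_descent du) -mulrA Tsgen_mul index_char_lmul IH mulrA -exprS.
  by congr (_ ^+ _ * _); rewrite !lenE (card_inversions_desc du).
rewrite {1}(heckeE x) mulr_suml; under eq_bigr => u _ do rewrite -scalerAl.
rewrite [LHS]index_char_sum [in RHS]/index_char mulr_suml; apply: eq_bigr => u _.
by rewrite hT mulrA.
Qed.

Lemma index_char1 : index_char 1 = 1.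
Proof. by rewrite -T1 index_charT len1 expr0. Qed.

End HeckeSupport.

(** * Laurent coefficients *)

Definition atq (p : {poly int}) : laurent := (map_poly intr p).[q].

HB.instance Definition _ := GRing.RMorphism.copy atq
  (horner_eval q \o map_poly intr).

Lemma atqX : atq 'X = q.
Proof. by rewrite /atq map_polyX hornerX. Qed.

(** The variable of the underlying polynomials is the square root of [q], hence the substitution of
    ['X^2]. *)
Lemma val_atq p : val (atq p) = FracField.tofrac (p \Po 'X^2).
Proof.
elim/poly_ind: p => [|p c IH]; first by rewrite comp_poly0 !rmorph0.
have valD (x y : laurent) : val (x + y) = val x + val y by exact: rmorphD.
have valM (x y : laurent) : val (x * y) = val x * val y by exact: rmorphM.
have -> : atq (p * 'X + c%:P) = atq p * q + atq c%:P by rewrite rmorphD rmorphM /= atqX.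
rewrite valD valM IH valM comp_polyD comp_polyM comp_polyX comp_polyC.
rewrite tofracD tofracM tofracXn; congr (_ + _).
by rewrite -[c]intz !rmorph_int.
Qed.

(** Identities between Laurent elements can thus be pulled back to [{poly int}], where coefficients
    are compared. *)
Lemma atq_inj : injective atq.
Proof.
move=> p r /(congr1 val); rewrite !val_atq => /eqP.
rewrite tofrac_eq -subr_eq0 -rmorphB /= comp_poly_eq0 ?size_polyXn //.
by rewrite subr_eq0 => /eqP.
Qed.

(* Positivity of the structure constants survives at q = 1, where q - 1 vanishes. *)
Definition nneg1 (x : laurent) : Prop := exists2 p, x = atq p & 0 <= p.[1].
Definition pos1 (x : laurent) : Prop := exists2 p, x = atq p & 0 < p.[1].

Lemma pos1_neq0 x : pos1 x -> x != 0.
Proof.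
case=> p -> p1; apply: contraTneq p1 => p0.
have /atq_inj -> : atq p = atq 0 by rewrite rmorph0.
by rewrite horner0 ltxx.
Qed.
Lemma pos1W x : pos1 x -> nneg1 x.
Proof. by case=> p -> /ltW p1; exists p. Qed.
Lemma nneg1_0 : nneg1 0.
Proof. by exists 0; rewrite ?rmorph0 ?horner0. Qed.
Lemma pos1_1 : pos1 1.
Proof. by exists 1; rewrite ?rmorph1 ?hornerC. Qed.
Lemma nneg1D x y : nneg1 x -> nneg1 y -> nneg1 (x + y).
Proof. by case=> p -> p1 [r -> r1]; exists (p + r); rewrite ?rmorphD // hornerD addr_ge0. Qed.
Lemma pos1D x y : pos1 x -> nneg1 y -> pos1 (x + y).
Proof. by case=> p -> p1 [r -> r1]; exists (p + r); rewrite ?rmorphD // hornerD ltr_pwDl. Qed.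
Lemma nneg1M x y : nneg1 x -> nneg1 y -> nneg1 (x * y).
Proof. by case=> p -> p1 [r -> r1]; exists (p * r); rewrite ?rmorphM // hornerM mulr_ge0. Qed.
Lemma pos1M x y : pos1 x -> pos1 y -> pos1 (x * y).
Proof. by case=> p -> p1 [r -> r1]; exists (p * r); rewrite ?rmorphM // hornerM mulr_gt0. Qed.
Lemma pos1_q : pos1 q.
Proof. by exists 'X; rewrite ?atqX ?hornerX. Qed.
Lemma nneg1_qB1 : nneg1 (q - 1).
Proof.
exists ('X - 1); first by rewrite rmorphB rmorph1 /= atqX.
by rewrite hornerD hornerN hornerX hornerC subrr.
Qed.

Lemma nneg1_sum (I : Type) (r : seq I) (F : I -> laurent) :
  (forall i, nneg1 (F i)) -> nneg1 (\sum_(i <- r) F i).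
Proof. by move=> hF; elim/big_rec: _ => [|i x _]; [exact: nneg1_0|exact: nneg1D]. Qed.

Section Positivity.
Variable n : nat.
Local Notation H := (hecke q n).
Implicit Types (x y z : H) (u v w : 'S_n).

(** At [q = 1] the Hecke algebra becomes the group algebra and [T u * T v] becomes [T (u * v)], so
    the coefficient at [v] moves to [u * v]. *)
Lemma mulT_pos u v y : (forall w, nneg1 (hcoef w y)) ->
  (forall w, nneg1 (hcoef w (T u * y : H))) /\
  (pos1 (hcoef v y) -> pos1 (hcoef (u * v)%g (T u * y : H))).
Proof.
move=> yP; elim/descent_ind: u => [|i u du [IHn IHp]].
  by split=> [w|]; rewrite T1 mul1r ?mul1g.
rewrite (T_descent q du) -mulrA Tsgen_mul; split=> [w|/IHp vp].
  rewrite hcoef_lmul; case: asc; first by apply: nneg1M => //; exact/pos1W/pos1_q.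
  by apply: nneg1D => //; apply: nneg1M => //; exact: nneg1_qB1.
rewrite hcoef_lmul [(sgen i * (u * v))%g]mulgA; case: asc.
  by apply: pos1M => //; exact: pos1_q.
by apply: pos1D => //; apply: nneg1M => //; exact: nneg1_qB1.
Qed.

(** A converse to [prod_support]: at [q = 1] nothing cancels, so every parabolic product occurs in
    the product of the [F J]. *)
Lemma prod_pos (s : seq ('I_n * 'I_n)) (F : 'I_n * 'I_n -> H) :
    (forall J v, nneg1 (hcoef v (F J))) ->
    (forall J v, parabolic J v -> pos1 (hcoef v (F J))) ->
  (forall v, nneg1 (hcoef v (\prod_(J <- s) F J))) /\
  (forall v, parabolic_product s v -> pos1 (hcoef v (\prod_(J <- s) F J))).
Proof.
move=> Fn Fp; elim: s => [|J s [IHn IHp]].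
  rewrite big_nil; split=> [v|_ ->]; rewrite -T1 hcoef_T.
    by case: eqP => _; [exact/pos1W/pos1_1|exact: nneg1_0].
  by rewrite eqxx; exact: pos1_1.
rewrite big_cons; split=> [v|_ [u [v [uJ vs ->]]]]; rewrite hcoef_mul.
  by apply: nneg1_sum => u; apply: nneg1M => //; case: (mulT_pos u v IHn).
rewrite (bigD1 u) //=; apply: pos1D.
  by apply: pos1M; [exact: Fp|case: (mulT_pos u v IHn) => _; apply; exact: IHp].
rewrite big_mkcond; apply: nneg1_sum => u'; case: ifP => _; last exact: nneg1_0.
by apply: nneg1M => //; case: (mulT_pos u' v IHn).
Qed.

End Positivity.

(** * The bar involution under the index representation *)

Lemma bar_coef_q : bar_coef q = qhV ^+ 2.
Proof. by rewrite rmorphXn /= bar_coef_qh. Qed.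

Lemma index_char_bar n (h : hecke q n) :
  index_char (bar h) = bar_coef (index_char h).
Proof.
rewrite /bar linear_sum /= [index_char h]/index_char rmorph_sum; apply: eq_bigr => w _.
rewrite linearZ /= rmorphM rmorphXn /= bar_coef_q; congr (_ * _).
set x : hecke q n := (T w^-1)^-1.
have : index_char x * q ^+ len w = 1.
  rewrite -[len w]len_inv -index_charT -index_charM -(index_char1 q n).
  by rewrite mulVr // T_unitq.
move/(congr1 (fun y => y * (qhV ^+ 2) ^+ len w)).
by rewrite mul1r -mulrA -exprMn -[q]/(qh ^+ 2) -exprMn [qh * _]mulrC qhK !expr1n mulr1.
Qed.

(** Inverting [q] and clearing denominators by [qh ^+ (2 * L)], which is [q ^+ L], reverses the list
    of coefficients. *)
Lemma atq_sum_rev (G : {poly int}) L : (size G <= L.+1)%N ->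
  qh ^+ (2 * L) * bar_coef (atq G) = atq (\sum_(k < L.+1) G`_k *: 'X^(L - k)).
Proof.
move=> sG; have {1}-> : G = \sum_(k < L.+1) G`_k *: 'X^k.
  rewrite -poly_def; apply/polyP => k; rewrite coef_poly ltnS.
  by case: leqP => // Lk; rewrite nth_default // (leq_trans sG).
rewrite !rmorph_sum mulr_sumr; apply: eq_bigr => k _ /=.
rewrite -![_ *: _]mul_polyC -[G`_k]intz !rmorphM !rmorph_int !rmorphXn /= !atqX.
rewrite mulrCA; congr (_ * _); rewrite bar_coef_q -exprM -[q]/(qh ^+ 2) -exprM.
have le : (k <= L)%N by rewrite -ltnS.
rewrite -{1}(subnK le) mulnDr exprD -mulrA -exprMn [qh * _]mulrC qhK.
by rewrite expr1n mulr1.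
Qed.

(** * Polynomials with constant term one, whose linear coefficients add under multiplication *)

Definition low_coefs (p : {poly int}) (c : int) := p`_0 = 1 /\ p`_1 = c.

Lemma low1 : low_coefs 1 0.
Proof. by rewrite /low_coefs !coefC. Qed.

Lemma lowM p r c d : low_coefs p c -> low_coefs r d -> low_coefs (p * r) (c + d).
Proof.
move=> [p0 p1] [r0 r1]; rewrite /low_coefs coef0M p0 r0 mulr1; split=> //.
by rewrite coefM !big_ord_recl big_ord0 /= p0 p1 r0 r1 mul1r mulr1 addr0 addrC.
Qed.

Lemma low_prod (I : Type) (r : seq I) (P : pred I) (F : I -> {poly int}) (c : I -> nat) :
  (forall i, low_coefs (F i) (c i)%:Z) ->
  low_coefs (\prod_(i <- r | P i) F i) (\sum_(i <- r | P i) c i)%N%:Z.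
Proof.
move=> FP; elim/big_rec2: _ => [|i x y _ IH]; first exact: low1.
by rewrite PoszD; apply: lowM.
Qed.

Lemma low_inj p c d : low_coefs p c -> low_coefs p d -> c = d.
Proof. by move=> [_ <-] [_ <-]. Qed.

Lemma low_neq0 p c : low_coefs p c -> p != 0.
Proof. by case=> p0 _; apply/eqP => e; move: p0; rewrite e coef0. Qed.

Definition qfact_poly (k : nat) : {poly int} := \prod_(i < k) \sum_(j < i.+1) 'X^j.

Lemma atq_qfact k : atq (qfact_poly k) = qfact k.
Proof.
rewrite rmorph_prod; apply: eq_bigr => i _; rewrite rmorph_sum.
by apply: eq_bigr => j _; rewrite rmorphXn /= atqX.
Qed.

(** Every q-integer factor other than the first has linear coefficient one; the truncated
    predecessor also covers the empty product at [k = 0]. *)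
Lemma low_qfact k : low_coefs (qfact_poly k) k.-1.
Proof.
have -> : k.-1 = (\sum_(i < k) (0 < i))%N.
  by case: k => [|k]; rewrite ?big_ord0 // big_ord_recl sum1_card card_ord.
apply: low_prod => i; rewrite /low_coefs !coef_sum; split.
  rewrite big_ord_recl coefXn big1 ?addr0 // => j _.
  by rewrite coefXn.
case: i => -[|i] _ /=; first by rewrite big_ord_recl big_ord0 coefXn.
rewrite !big_ord_recl !coefXn big1 ?addr0 // => j _.
by rewrite coefXn.
Qed.

(** * Kazhdan-Lusztig elements *)

Lemma hcoef_KL n (C : 'S_n -> hecke q n) (P : 'S_n -> 'S_n -> {poly int}) v w :
    qh ^+ len w *: C w = \sum_(v | bruhat v w) (map_poly intr (P v w)).[q] *: T v ->
  hcoef v (KL_tilde C w) = if bruhat v w then atq (P v w) else 0.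
Proof.
move=> CE; rewrite /KL_tilde CE (raddf_sum (hcoef v)) /= big_mkcond (bigD1 v) //=.
rewrite big1 ?addr0 => [|u uv]; case: ifP => // _.
  by rewrite hcoefZ hcoef_T eqxx mulr1.
by rewrite hcoefZ hcoef_T eq_sym (negPf uv) mulr0.
Qed.

Lemma KL_support n (C : 'S_n -> hecke q n) v w : KL_basis C ->
  hcoef v (KL_tilde C w) != 0 -> bruhat v w.
Proof.
by case=> P [_ [CE _]]; rewrite (hcoef_KL v (CE w)); case: ifP; rewrite ?eqxx.
Qed.

Lemma KL_diag n (C : 'S_n -> hecke q n) w : KL_basis C ->
  hcoef w (KL_tilde C w) = 1.
Proof.
case=> P [_ [CE [_ [_ [Pww _]]]]]; rewrite (hcoef_KL w (CE w)) Pww rmorph1.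
by rewrite /bruhat connect0.
Qed.

(** With nonnegative coefficients and constant term one, the polynomial is at least one at 1. *)
Lemma KL_pos1 n (C : 'S_n -> hecke q n) v w : KL_basis C -> bruhat v w ->
  pos1 (hcoef v (KL_tilde C w)).
Proof.
case=> P [_ [CE [Pn [P0 _]]]] vw; rewrite (hcoef_KL v (CE w)) vw.
exists (P v w) => //; have /polyOverP Pge := Pn _ _ vw.
rewrite horner_coef; case: (size _) (nth_default 0 (s := P v w)) => [|k] d.
  by have := P0 _ _ vw; rewrite d.
rewrite big_ord_recl P0 // mul1r expr0 ltr_pwDl //.
by apply: sumr_ge0 => i _; rewrite expr1n mulr1; apply: Pge.
Qed.

Lemma KL_nneg1 n (C : 'S_n -> hecke q n) v w : KL_basis C ->
  nneg1 (hcoef v (KL_tilde C w)).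
Proof.
move=> hC; case: (eqVneq (hcoef v (KL_tilde C w)) 0) => [->|]; first exact: nneg1_0.
by move=> /(KL_support hC)/(KL_pos1 hC)/pos1W.
Qed.

(* Bar invariance makes the Poincare polynomial palindromic, and by the degree
   bound only w and its coatoms contribute to its two top coefficients. *)
Lemma KL_poincare n (C : 'S_n -> hecke q n) w : KL_basis C ->
  exists2 G, index_char (KL_tilde C w) = atq G & low_coefs G #|coatoms w|.
Proof.
case=> P [Cbar [CE [_ [P0 [Pww Pdeg]]]]]; set L := len w.
pose G := \sum_(v | bruhat v w) P v w * 'X^(len v).
have GE : index_char (KL_tilde C w) = atq G.
  rewrite /index_char rmorph_sum [RHS]big_mkcond; apply: eq_bigr => v _ /=.
  rewrite (hcoef_KL v (CE w)); case: ifP => _; last by rewrite mul0r.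
  by rewrite rmorphM rmorphXn /= atqX.
exists G => //.
have Gcoef k : G`_k = \sum_(v | bruhat v w) if (k < len v)%N then 0 else (P v w)`_(k - len v).
  by rewrite coef_sum; apply: eq_bigr => v _; rewrite coefMXn.
(* Twice the degree is at most [L - len v - 1], so a positive exponent not below this bound exceeds
   the degree. *)
have P_high v k : bruhat v w -> v != w -> (0 < k)%N -> (L - len v - 1 <= k)%N ->
    (P v w)`_k = 0.
  move=> vw ne k0 kL; have vlt : bruhat_lt v w by rewrite /bruhat_lt ne.
  apply: nth_default; move: (Pdeg _ _ vlt) kL k0; rewrite -/L.
  by move: (size _) (L) (len v) => a b c; lia.
have sG : (size G <= L.+1)%N.
  apply/leq_sizeP => k Lk; rewrite Gcoef big1 // => v vw.
  have vL := bruhat_len vw; rewrite -/L in vL; rewrite ltnNge (leq_trans vL (ltnW Lk)) /=.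
  have [->|ne] := eqVneq v w; last by apply: P_high => //; lia.
  by rewrite Pww coefC -/L subn_eq0 leqNgt Lk.
have Gsym : G = \sum_(k < L.+1) G`_k *: 'X^(L - k).
  apply: atq_inj; rewrite -(atq_sum_rev sG) -GE.
  have -> : index_char (KL_tilde C w) = qh ^+ L * index_char (C w) by rewrite linearZ.
  (* As [C w] is bar invariant, only the factor [qh ^+ L] is inverted, and [qh ^+ (2 * L)] restores
     it. *)
  rewrite rmorphM rmorphXn /= bar_coef_qh -index_char_bar Cbar mulrA; congr (_ * _).
  by rewrite mul2n -addnn exprD -mulrA -exprMn [qh * _]mulrC qhK expr1n mulr1.
have Grev k : (k <= L)%N -> G`_k = G`_(L - k).
  move=> kL; rewrite {1}Gsym coef_sum.
  have lt : (L - k < L.+1)%N by rewrite ltnS leq_subr.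
  rewrite (bigD1 (Ordinal lt)) //= coefZ coefXn subKn // eqxx mulr1 big1 ?addr0 // => i ne.
  rewrite coefZ coefXn; case: eqP => [e|]; last by rewrite mulr0.
  case/eqP: ne; apply: val_inj => /=; have := ltn_ord i; lia.
split.
  rewrite Grev // subn0 Gcoef (bigD1 w) ?/bruhat ?connect0 //= ltnn subnn Pww coefC eqxx.
  rewrite big1 ?addr0 // => v /andP[vw ne].
  have /bruhat_lt_len lt : bruhat_lt v w by rewrite /bruhat_lt ne.
  by rewrite ltnNge (ltnW lt) /=; apply: P_high => //; rewrite -/L in lt; lia.
(* The exponent [L - 1] would truncate at [L = 0]; there [G] is constant and [w] has no coatoms. *)
case: (posnP L) => [L0|L_gt0].
  rewrite nth_default; last by rewrite -L0.
  have -> : coatoms w = set0; last by rewrite cards0.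
  by apply/setP => v; rewrite !inE -/L L0 andbF.
rewrite Grev // Gcoef -sum1_card (big_morph _ PoszD (erefl 0%:Z)).
rewrite [LHS]big_mkcond [RHS]big_mkcond; apply: eq_bigr => v _.
rewrite inE /bruhat_lt; have [->|ne] := eqVneq v w.
  by rewrite /bruhat connect0 /= -/L; case: ltnP => //; lia.
rewrite /= ; case: ifP => //= vw; rewrite -/L.
have /bruhat_lt_len lt : bruhat_lt v w by rewrite /bruhat_lt ne.
rewrite -/L in lt; have [e|nv] := eqVneq (len v).+1 L.
  by rewrite -e subn1 /= ltnn subnn P0.
rewrite ltnNge; have -> /= : (len v <= L - 1)%N by lia.
by apply: P_high => //; move: (L) (len v) lt nv => a b; lia.
Qed.

Theorem theorem5p2 (n : nat) (C : 'S_n -> hecke q n) (hC : KL_basis C)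
    (w : 'S_n) (h4231 : avoids p4231 w) (h3412 : ~~ avoids p3412 w)
    (hgap : (1 < gap3412 w)%N) :
  ~ has_reversal_factorization C w.
Proof.
move=> [m [A [ne eqA]]].
pose F : {poly int} := \prod_(i < m) \prod_(j < m | (i < j)%N) qfact_poly #|overlap A i j|.
have lowF : low_coefs F (\sum_(i < m) \sum_(j < m | (i < j)%N) #|overlap A i j|.-1)%N.
  by apply: low_prod => i; apply: low_prod => j; apply: low_qfact.
have atqF : atq F = revfact_denom A.
  rewrite rmorph_prod; apply: eq_bigr => i _; rewrite rmorph_prod.
  by apply: eq_bigr => j _; apply: atq_qfact.
have f0 : revfact_denom A != 0.
  rewrite -atqF -(rmorph0 atq) (inj_eq atq_inj); exact: low_neq0 lowF.
have hfrac v (h : hecke q n) : hcoef v (hecke_frac h) = val (hcoef v h).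
  rewrite (raddf_sum (hcoef v)) -[RHS](sum_pick (fun u => val (hcoef u h))) /=.
  by apply: eq_bigr => u _; rewrite hcoefZ hcoef_T.
(* Clearing the nonzero denominator brings the identity back from the fraction field to Laurent
   coefficients. *)
have {}eqA : revfact_denom A *: KL_tilde C w =
    \prod_(J <- A) KL_tilde C (reversal J).
  apply/hcoefP => v; apply: val_inj; rewrite hcoefZ.
  have valM (x y : laurent) : val (x * y) = val x * val y by exact: rmorphM.
  have v0 : val (0 : laurent) = 0 by exact: rmorph0.
  have vf0 : val (revfact_denom A) != 0.
    by apply: contra_neq f0 => e; apply: val_inj; rewrite e v0.
  by rewrite valM -(hfrac v (KL_tilde C w)) eqA hcoefZ hfrac big_tuple mulVKf.
(* The coefficient of the product at [w] is the nonzero denominator, because [KL_tilde C w] has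
   coefficient one there. *)
have Aw : parabolic_product A w.
  apply: (prod_support (F := fun J => KL_tilde C (reversal J))) => [J v _ /(KL_support hC)|].
    exact/parabolic_bruhat/reversal_parabolic.
  by rewrite -eqA hcoefZ (KL_diag w hC) mulr1.
(* By positivity every parabolic product occurs on the right, hence lies below [w] in the Bruhat
   order. *)
have Amax v : parabolic_product A v -> (len v <= len w)%N.
  have [_ prodP] := prod_pos A (F := fun J => KL_tilde C (reversal J))
    (fun J v => KL_nneg1 v _ hC) (fun J v vJ => KL_pos1 hC (bruhat_reversal vJ)).
  move=> /prodP/pos1_neq0; rewrite -eqA hcoefZ => n0.
  apply/bruhat_len/(KL_support hC); apply: contraNneq n0 => ->.
  by rewrite mulr0.
have [Gw GwE lowG] := KL_poincare w hC.
have /boolp.choice[G GP] : forall J, exists G, index_char (KL_tilde C (reversal J)) = atq G /\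
    low_coefs G #|coatoms (reversal J)|.
  by move=> J; have [G] := KL_poincare (reversal J) hC; exists G.
have eqG : F * Gw = \prod_(J <- A) G J.
  apply: atq_inj; rewrite rmorphM /= atqF -GwE rmorph_prod.
  have -> : revfact_denom A * index_char (KL_tilde C w) =
      index_char (revfact_denom A *: KL_tilde C w) by rewrite [RHS]linearZ.
  rewrite eqA (big_morph _ (@index_charM _ q n) (index_char1 q n)).
  by apply: eq_bigr => J _; case: (GP J).
(* Comparing linear coefficients turns the factorization into an equation between numbers of coatoms
   and sizes of overlaps. *)
have := low_prod A xpredT (F := G) (fun J => proj2 (GP J)).
rewrite -eqG => /(low_inj (lowM lowF lowG)); rewrite -PoszD => -[] /eqP.
rewrite big_tuple => /eqP cnt.
have := covers_lt_of_3412 ne Aw Amax h4231 h3412 hgap.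
apply/negP; rewrite -leqNgt.
apply: (@leq_trans (\sum_(i < m) #|coatoms (reversal (tnth A i))|)%N).
  by apply: leq_sum => i _; apply: coatoms_reversal.
by rewrite -cnt addnC leq_add2r card_coatoms_le.
Qed.
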